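(* Suppose that $K$, $\mu$, $r$ satisfy the kernel assumption stated in the context. (i) Each constant vector $b\in\mathbb{R}^n$ belongs to $\mathcal{H}_\mu$ and satisfies $\|b\|_{\mathcal{H}_\mu}=\big(\int_{\mathrm{supp}\,\mu}r(\theta)\,\mu(\mathrm{d}\theta)\big)^{1/2}|b|$. Each constant matrix $\sigma\in\mathbb{R}^{n\times d}$ belongs to the space $L_2(\mathbb{R}^d;\mathcal{H}_\mu)$ of Hilbert–Schmidt operators from $\mathbb{R}^d$ to $\mathcal{H}_\mu$ and satisfies $\|\sigma\|_{L_2(\mathbb{R}^d;\mathcal{H}_\mu)}=\big(\int_{\mathrm{supp}\,\mu}r(\theta)\,\mu(\mathrm{d}\theta)\big)^{1/2}|\sigma|$. (ii) The map $e^{-\cdot t}:y\mapsto(\theta\mapsto e^{-\theta t}y(\theta))$ is a linear contraction operator on $\mathcal{H}_\mu$ for any $t\ge0$. Furthermore, $\{e^{-\cdot t}\}_{t\ge0}$ is a $C_0$-semigroup on $\mathcal{H}_\mu$ with the infinitesimal generator $A:\mathcal{D}(A)\to\mathcal{H}_\mu$ given by $$\mathcal{D}(A)=\Big\{y\in\mathcal{H}_\mu\ \Big|\ \int_{\mathrm{supp}\,\mu}\theta^2r(\theta)|y(\theta)|^2\,\mu(\mathrm{d}\theta)<\infty\Big\},\qquad(Ay)(\theta)=-\theta y(\theta),\ \theta\in\mathrm{supp}\,\mu,\ y\in\mathcal{D}(A).$$ The map $A:\mathcal{D}(A)\to\mathcal{H}_\mu\hookrightarrow\mathcal{V}^*_\mu$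 can be uniquely extended to a linear contraction operator (again denoted by $A$) from $\mathcal{V}_\mu$ to $\mathcal{V}^*_\mu$. Furthermore, $${}_{\mathcal{V}^*_\mu}\langle Ay,y\rangle_{\mathcal{V}_\mu}=-\|y\|_{\mathcal{V}_\mu}^2+\|y\|_{\mathcal{H}_\mu}^2\le0$$ for any $y\in\mathcal{V}_\mu$. (iii) Any $y\in\mathcal{V}_\mu$ is $\mu$-integrable and satisfies $$\int_{\mathrm{supp}\,\mu}|y(\theta)|\,\mu(\mathrm{d}\theta)\le\Big(\int_{\mathrm{supp}\,\mu}r(\theta)\,\mu(\mathrm{d}\theta)\Big)^{1/2}\|y\|_{\mathcal{V}_\mu}.$$ Furthermore, for any $\varepsilon>0$, there exists a constant $M=M(\mu,\varepsilon)>0$ such that $$\Big(\int_{\mathrm{supp}\,\mu}|y(\theta)|\,\mu(\mathrm{d}\theta)\Big)^2\le\varepsilon\|y\|_{\mathcal{V}_\mu}^2+M\|y\|_{\mathcal{H}_\mu}^2$$ for any $y\in\mathcal{V}_\mu$.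
   Context: $n,d\in\mathbb{N}$; $|\cdot|$ is the Euclidean norm on $\mathbb{R}^n$ and the Frobenius norm on $\mathbb{R}^{n\times d}$. Kernel assumption. $K:(0,\infty)\to[0,\infty)$ is completely monotone, i.e. infinitely differentiable with $(-1)^kK^{(k)}(t)\ge0$ for all $t>0$ and integers $k\ge0$; $\mu$ is the unique Radon measure on $[0,\infty)$ with $K(t)=\int_{[0,\infty)}e^{-\theta t}\mu(\mathrm{d}\theta)$ for all $t>0$ (Bernstein's theorem); $\mathrm{supp}\,\mu$ is its support. There is a non-increasing Borel measurable $r:[0,\infty)\to(0,\infty)$, fixed once and for all, with $1\wedge\theta^{-1/2}\le r(\theta)\le1$ for all $\theta\ge0$ and $\int_{\mathrm{supp}\,\mu}r(\theta)\,\mu(\mathrm{d}\theta)<\infty$. Spaces. $\mathcal{H}_\mu$ is the separable Hilbert space of ($\mu$-a.e. equivalence classes of) Borel functions $y:\mathrm{supp}\,\mu\to\mathbb{R}^n$ with $\|y\|_{\mathcal{H}_\mu}^2:=\int_{\mathrm{supp}\,\mu}r(\theta)|y(\theta)|^2\mu(\mathrm{d}\theta)<\infty$, with inner product $\langle y_1,y_2\rangle_{\mathcal{H}_\mu}=\int_{\mathrm{supp}\,\mu}r(\theta)\langle y_1(\theta),y_2(\theta)\rangle\mu(\mathrm{d}\theta)$. $\mathcal{V}_\mu$ is the Banach space of those with $\|y\|_{\mathcal{V}_\mu}^2:=\int_{\mathrm{supp}\,\mu}(\theta+1)r(\theta)|y(\theta)|^2\mu(\mathrm{d}\theta)<\infty$.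 Identifying $\mathcal{H}_\mu$ with its dual gives a Gelfand triplet $\mathcal{V}_\mu\hookrightarrow\mathcal{H}_\mu\hookrightarrow\mathcal{V}^*_\mu$; the dual $\mathcal{V}^*_\mu$ of $\mathcal{V}_\mu$ is identified with the space of Borel functions $y:\mathrm{supp}\,\mu\to\mathbb{R}^n$ with $\|y\|_{\mathcal{V}^*_\mu}^2=\int_{\mathrm{supp}\,\mu}(\theta+1)^{-1}r(\theta)|y(\theta)|^2\mu(\mathrm{d}\theta)<\infty$, and the duality pairing satisfies ${}_{\mathcal{V}^*_\mu}\langle y',y\rangle_{\mathcal{V}_\mu}=\langle y',y\rangle_{\mathcal{H}_\mu}$ for $y\in\mathcal{V}_\mu$, $y'\in\mathcal{H}_\mu$. ''Contraction'' means operator norm at most $1$. A vector $b\in\mathbb{R}^n$ is regarded as the constant function $\theta\mapsto b$, and a matrix $\sigma\in\mathbb{R}^{n\times d}$ as the operator $w\mapsto(\theta\mapsto\sigma w)$. *)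

(* Defs.v *)
From HB Require Import structures.
From mathcomp Require Import all_boot all_order all_algebra.
From mathcomp Require Import generic_quotient ring_quotient.
From mathcomp Require Import all_classical all_reals all_analysis.
From mathcomp Require Import measurable_realfun ring lra.
Set Implicit Arguments.
Unset Strict Implicit.
Unset Printing Implicit Defensive.
Import Order.TTheory GRing.Theory Num.Theory.
Import numFieldNormedType.Exports.

Local Open Scope classical_set_scope.
Local Open Scope ring_scope.

Section euclidean.
Context {R : realType}.

(* The library norm of a matrix is the max norm, hence the definition below:
   Frobenius norm in general, Euclidean norm on column vectors. *)
Definition enorm m n (A : 'M[R]_(m, n)) : R :=
  Num.sqrt (\sum_i \sum_j A i j ^+ 2).

Definition dot n (u v : 'cV[R]_n) : R := \sum_i u i 0 * v i 0.

Lemma enorm_ge0 m n (A : 'M[R]_(m, n)) : 0 <= enorm A.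
Proof. exact: sqrtr_ge0. Qed.

Lemma enorm_sqr n (u : 'cV[R]_n) : enorm u ^+ 2 = dot u u.
Proof.
rewrite /enorm sqr_sqrtr; last first.
  by apply: sumr_ge0 => i _; apply: sumr_ge0 => j _; exact: sqr_ge0.
by apply: eq_bigr => i _; rewrite big_ord1 expr2.
Qed.

Lemma dotC n (u v : 'cV[R]_n) : dot u v = dot v u.
Proof. by apply: eq_bigr => i _; rewrite mulrC. Qed.

Lemma dotDl n (u v x : 'cV[R]_n) : dot (u + v) x = dot u x + dot v x.
Proof. by rewrite /dot -big_split; apply: eq_bigr => i _; rewrite mxE mulrDl. Qed.

Lemma dotZl n a (u x : 'cV[R]_n) : dot (a *: u) x = a * dot u x.
Proof. by rewrite /dot mulr_sumr; apply: eq_bigr => i _; rewrite mxE mulrA. Qed.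

Lemma dotDr n (u v x : 'cV[R]_n) : dot x (u + v) = dot x u + dot x v.
Proof. by rewrite dotC dotDl !(dotC x). Qed.

Lemma dotZr n a (u x : 'cV[R]_n) : dot x (a *: u) = a * dot x u.
Proof. by rewrite dotC dotZl (dotC x). Qed.

Lemma dot_ge0 n (u : 'cV[R]_n) : 0 <= dot u u.
Proof. by rewrite -enorm_sqr sqr_ge0. Qed.

Lemma dot_eq0 n (u : 'cV[R]_n) : dot u u = 0 -> u = 0.
Proof.
move=> /eqP; rewrite psumr_eq0 => [/allP u0|i _]; last by rewrite -expr2 sqr_ge0.
apply/matrixP => i j; rewrite ord1 mxE; apply/eqP.
by have := u0 i (mem_index_enum _); rewrite mulf_eq0 orbb.
Qed.

Lemma dot_bound n (u v : 'cV[R]_n) : `|dot u v| <= dot u u + dot v v.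
Proof.
have h (a : R) : dot (u + a *: v) (u + a *: v) =
    dot u u + 2 * a * dot u v + a ^+ 2 * dot v v.
  by rewrite !(dotDl, dotDr, dotZl, dotZr) (dotC v u); ring.
have := dot_ge0 (u + 1 *: v); have := dot_ge0 (u + (-1) *: v).
rewrite !h; move: (dot_ge0 u) (dot_ge0 v) => ? ? ? ?.
by rewrite ler_norml; apply/andP; split; lra.
Qed.

End euclidean.

Section support.
Context {R : realType} (mu : {measure set (measurableTypeR R) -> \bar R}).

Definition supp : set R := [set x | forall U, open_nbhs x U -> (0 < mu U)%E].

Lemma supp_closed : closed supp.
Proof.
rewrite -openC openE => x /= /existsNP[U] /not_implyP[[oU Ux] /negP muU].
rewrite /interior; apply: filterS (open_nbhs_nbhs (conj oU Ux)) => y Uy /=.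
by move=> /(_ U (conj oU Uy)); apply/negP.
Qed.

Lemma supp_measurable : measurable (supp : set (measurableTypeR R)).
Proof. exact: (closed_measurable supp_closed). Qed.

End support.

(* The weights occurring in the norms are strictly positive on the support, so
   that equality almost everywhere is the same for all of them. *)
Record weight (R : realType) (mu : {measure set (measurableTypeR R) -> \bar R}) :=
  Weight {
    weight_fun :> R -> R ;
    weight_meas : measurable_fun (supp mu : set (measurableTypeR R)) weight_fun ;
    weight_gt0 : forall x, supp mu x -> 0 < weight_fun x }.

Section square_integrable.
Context {R : realType} {mu : {measure set (measurableTypeR R) -> \bar R}}.
Context {n : nat}.
Implicit Types (w : weight mu) (f g h : R -> 'cV[R]_n).

(* Componentwise: the Borel sigma-algebra of R^n is the product one. *)
Definition vmeasurable f :=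
  forall i, measurable_fun (supp mu : set (measurableTypeR R)) (fun x => f x i 0).

Definition sqint w f : \bar R :=
  (\int[mu]_(x in supp mu) (w x * enorm (f x) ^+ 2)%:E)%E.

Definition bochner_integrable f := vmeasurable f /\
  mu.-integrable (supp mu) (fun x => (enorm (f x))%:E).

Definition square_integrable w f := vmeasurable f /\ (sqint w f < +oo)%E.

Definition ip w f g : R := \int[mu]_(x in supp mu) (w x * dot (f x) (g x)).

Local Notation mS := (supp_measurable mu).

Lemma vmeasurable_comb a f g :
  vmeasurable f -> vmeasurable g -> vmeasurable (a *: f + g).
Proof.
move=> mf mg i.
rewrite (_ : (fun x => _) = (fun x => a * f x i 0) \+ (fun x => g x i 0)).
  by apply: measurable_funD (mg i); apply: measurable_funM (mf i).
by apply/funext => x; rewrite /= !fctE !mxE.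
Qed.

Lemma measurable_dot f g : vmeasurable f -> vmeasurable g ->
  measurable_fun (supp mu : set (measurableTypeR R)) (fun x => dot (f x) (g x)).
Proof.
move=> mf mg; rewrite /dot.
by apply: measurable_sum => i; apply: measurable_funM.
Qed.

Lemma measurable_wdot w f g : vmeasurable f -> vmeasurable g ->
  measurable_fun (supp mu : set (measurableTypeR R))
    (fun x => w x * dot (f x) (g x)).
Proof.
by move=> mf mg; apply: measurable_funM (weight_meas w) (measurable_dot mf mg).
Qed.

Lemma sqintE w f :
  sqint w f = (\int[mu]_(x in supp mu) (w x * dot (f x) (f x))%:E)%E.
Proof. by apply: eq_integral => x _; rewrite enorm_sqr. Qed.

Lemma wdot_ge0 w f x : supp mu x -> 0 <= w x * dot (f x) (f x).
Proof. by move=> Sx; rewrite mulr_ge0 ?dot_ge0// ltW// weight_gt0. Qed.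

Lemma sqint_integrable w f : square_integrable w f ->
  mu.-integrable (supp mu) (fun x => (w x * dot (f x) (f x))%:E).
Proof.
case=> mf; rewrite sqintE => fi; apply/integrableP; split.
  by apply/measurable_EFinP; exact: measurable_wdot.
apply: le_lt_trans fi; rewrite le_eqVlt; apply/orP; left; apply/eqP.
by apply: eq_integral => x; rewrite inE => Sx /=; rewrite ger0_norm// wdot_ge0.
Qed.

Lemma ip_integrable w f g : square_integrable w f -> square_integrable w g ->
  mu.-integrable (supp mu) (fun x => (w x * dot (f x) (g x))%:E).
Proof.
move=> Lf Lg; have [mf _] := Lf; have [mg _] := Lg.
apply: (@le_integrable _ _ _ _ _ mS _
  (fun x => (w x * dot (f x) (f x))%:E + (w x * dot (g x) (g x))%:E)%E).
- by apply/measurable_EFinP; exact: measurable_wdot.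
- move=> x Sx /=; rewrite lee_fin -mulrDr !normrM.
  rewrite ler_wpM2l// [leRHS]ger0_norm ?addr_ge0 ?dot_ge0//.
  exact: dot_bound.
- by apply: integrableD; [exact: mS|exact: sqint_integrable|exact: sqint_integrable].
Qed.

Lemma sqint_ip w f : square_integrable w f -> sqint w f = (ip w f f)%:E.
Proof.
move=> Lf; rewrite sqintE /ip /Rintegral fineK//.
by apply: integrable_fin_num; [exact: mS|exact: sqint_integrable].
Qed.

Lemma ipC w f g : ip w f g = ip w g f.
Proof. by apply: eq_Rintegral => x _; rewrite dotC. Qed.

Lemma ip_ge0 w f : 0 <= ip w f f.
Proof. by apply: Rintegral_ge0 => x; exact: wdot_ge0. Qed.

Lemma square_integrable_comb w a f g : square_integrable w f ->
  square_integrable w g -> square_integrable w (a *: f + g).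
Proof.
move=> Lf Lg; have [mf fi] := Lf; have [mg gi] := Lg.
split; first exact: vmeasurable_comb.
rewrite sqintE; apply: (@le_lt_trans _ _ (\int[mu]_(x in supp mu)
   ((2 * a ^+ 2)%:E * (w x * dot (f x) (f x))%:E +
    2%:E * (w x * dot (g x) (g x))%:E))%E).
  apply: ge0_le_integral; first exact: mS.
  - by move=> x Sx; rewrite lee_fin; exact: (wdot_ge0 w (a *: f + g) Sx).
  - apply/measurable_EFinP.
    by apply: (@measurable_wdot w (a *: f + g) (a *: f + g)); exact: vmeasurable_comb.
  - by apply: emeasurable_funD; apply: measurable_funeM;
      apply/measurable_EFinP; exact: measurable_wdot.
  - move=> x Sx; rewrite -!EFinM -EFinD lee_fin.
    have := dot_ge0 (a *: f x - g x).
    have wx : 0 < w x by exact: weight_gt0.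
    rewrite -subr_ge0 [X in _ -> 0 <= X](_ : _ = w x * dot (a *: f x - g x)
      (a *: f x - g x)); first by move=> ?; rewrite mulr_ge0// ltW.
    by rewrite !fctE -(scaleN1r (g x)) !(dotDl, dotDr, dotZl, dotZr) (dotC (g x) (f x)); ring.
apply: integrable_lty => //; first exact: mS.
apply: integrableD; first exact: mS.
  by apply: integrableZl; [exact: mS|exact: sqint_integrable].
by apply: integrableZl; [exact: mS|exact: sqint_integrable].
Qed.

Lemma ip_comb w a f g h : square_integrable w f -> square_integrable w g ->
  square_integrable w h -> ip w (a *: f + g) h = a * ip w f h + ip w g h.
Proof.
move=> Lf Lg Lh; rewrite /ip.
rewrite -RintegralZl//; [|exact: mS|exact: ip_integrable].
rewrite -RintegralD//; [|exact: mS| |exact: ip_integrable].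
  by apply: eq_Rintegral => x _; rewrite !fctE dotDl dotZl; ring.
by under [X in _.-integrable _ X]eq_fun do rewrite EFinM;
   apply: integrableZl; [exact: mS|exact: ip_integrable].
Qed.

Lemma ip_CS w f g : square_integrable w f -> square_integrable w g ->
  `|ip w f g| <= Num.sqrt (ip w f f) * Num.sqrt (ip w g g).
Proof.
move=> Lf Lg.
have key a : 0 <= a ^+ 2 * ip w f f + 2 * a * ip w f g + ip w g g.
  have := ip_ge0 w (a *: f + g).
  rewrite ip_comb//; last exact: square_integrable_comb.
  rewrite (ipC _ f) (ipC _ g) !ip_comb// (ipC _ g f) => /le_trans; apply.
  by rewrite le_eqVlt; apply/orP; left; apply/eqP; ring.
rewrite -sqrtrM ?ip_ge0// -sqrtr_sqr ler_sqrt; last by rewrite mulr_ge0 ?ip_ge0.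
have := ip_ge0 w f; rewrite le_eqVlt => /predU1P[f0|f0].
  rewrite -f0 mul0r; have [->|fg0] := eqVneq (ip w f g) 0; first by rewrite expr0n.
  have := key (- (ip w g g + 1) / (2 * ip w f g)); rewrite -f0 mulr0 add0r.
  rewrite [X in 0 <= X -> _](_ : _ = - 1); first by rewrite oppr_ge0 ler10.
  by field.
have := key (- ip w f g / ip w f f).
rewrite [X in 0 <= X -> _](_ : _ =
  (ip w f f * ip w g g - ip w f g ^+ 2) / ip w f f); last by field; rewrite gt_eqF.
by rewrite pmulr_lge0 ?invr_gt0// subr_ge0.
Qed.

End square_integrable.
Arguments vmeasurable {R} mu {n} f.
Arguments bochner_integrable {R} mu {n} f.


Section L2_functions.
Context {R : realType} {mu : {measure set (measurableTypeR R) -> \bar R}}.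
Variables (w : weight mu) (n : nat).

Definition L2pred : {pred R -> 'cV[R]_n} := mem [set f | square_integrable w f].

Lemma L2pred_submod : submod_closed L2pred.
Proof.
split=> [|a f g]; last by rewrite !inE; exact: square_integrable_comb.
rewrite inE; split=> [i|].
  rewrite (_ : (fun x => _) = cst 0); first exact: measurable_cst.
  by apply/funext => x; exact: mxE.
rewrite /sqint integral0_eq ?ltry// => x _.
rewrite enorm_sqr /dot big1 ?mulr0// => i _.
by rewrite [X in X * _](_ : _ = 0) ?mul0r; [|exact: mxE].
Qed.

HB.instance Definition _ :=
  GRing.isSubmodClosed.Build _ _ L2pred L2pred_submod.

Record L2fun := L2Fun { L2val :> R -> 'cV[R]_n ; L2valP : L2val \in L2pred }.

HB.instance Definition _ := [isSub for L2val].
HB.instance Definition _ := [Choice of L2fun by <:].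
HB.instance Definition _ := [SubChoice_isSubLmodule of L2fun by <:].

Definition L2null : {pred L2fun} :=
  mem [set f : L2fun | ae_eq mu (supp mu) (f : R -> 'cV[R]_n) (cst 0)].

Lemma L2null_zmod_closed : zmod_closed L2null.
Proof.
split=> [|f g]; rewrite !inE; first exact: ae_eq_refl.
move=> f0 g0; apply: filterS2 f0 g0 => x fx gx Sx.
by rewrite /= !fctE fx// gx// subrr.
Qed.

HB.instance Definition _ :=
  GRing.isZmodClosed.Build _ L2null L2null_zmod_closed.

End L2_functions.

(* The space of classes, modulo equality mu-almost everywhere on the support, of
   Borel functions which are square integrable with respect to the weight. *)
Section L2_space.
Local Open Scope quotient_scope.
Context {R : realType} {mu : {measure set (measurableTypeR R) -> \bar R}}.
Context (w : weight mu) (n : nat).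

Definition L2 : Type := Quotient.quot (@L2null _ _ w n).
HB.instance Definition _ := GRing.Zmodule.on L2.

Definition L2_class (f : R -> 'cV[R]_n) (Lf : square_integrable w f) : L2 :=
  \pi_L2 (L2Fun (mem_set Lf)).

Definition L2_fun (y : L2) : R -> 'cV[R]_n := repr y.

Lemma L2_funP (y : L2) : square_integrable w (L2_fun y).
Proof. exact: set_mem (L2valP (repr y)). Qed.

Local Notation "f =ae g" := (ae_eq mu (supp mu) f g) (at level 70).

Lemma pi_ae (f g : L2fun w n) :
  (\pi_L2 f = \pi_L2 g) <-> ((f : R -> 'cV[R]_n) =ae (g : R -> 'cV[R]_n)).
Proof.
rewrite (rwP eqP) -Quotient.idealrBE inE /=.
split; apply: filterS => x /[apply]; rewrite /= !fctE.
  by move=> /eqP; rewrite subr_eq0 => /eqP.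
by move=> ->; rewrite subrr.
Qed.

Lemma L2_classE f (Lf : square_integrable w f) : L2_fun (L2_class Lf) =ae f.
Proof. by rewrite -(pi_ae _ (L2Fun (mem_set Lf))) reprK. Qed.

Lemma L2_eqP (y z : L2) : y = z <-> L2_fun y =ae L2_fun z.
Proof. by rewrite -(pi_ae (repr y) (repr z)) !reprK. Qed.

Lemma L2_funD (y z : L2) : L2_fun (y + z) =ae (fun x => L2_fun y x + L2_fun z x).
Proof.
rewrite -(pi_ae _ (repr y + repr z)) reprK.
by rewrite -{1}[y]reprK -{1}[z]reprK !piE.
Qed.

Definition L2_scale (a : R) (y : L2) : L2 := \pi_L2 (a *: repr y).

Lemma L2_funZ_subproof a (y : L2) :
  L2_fun (L2_scale a y) =ae (fun x => a *: L2_fun y x).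
Proof. by rewrite -(pi_ae _ (a *: repr y)) reprK. Qed.

Lemma L2_scaleA a b (y : L2) : L2_scale a (L2_scale b y) = L2_scale (a * b) y.
Proof.
apply/L2_eqP; apply: filterS3 (L2_funZ_subproof a (L2_scale b y))
  (L2_funZ_subproof b y) (L2_funZ_subproof (a * b) y) => x h1 h2 h3 Sx.
by rewrite h1// h2// h3// scalerA.
Qed.

Lemma L2_scale1 : left_id 1 L2_scale.
Proof.
by move=> y; apply/L2_eqP; apply: filterS (L2_funZ_subproof 1 y) => x h Sx;
  rewrite h// scale1r.
Qed.

Lemma L2_scaleDr : right_distributive L2_scale +%R.
Proof.
move=> a y z; apply/L2_eqP.
have h1 := L2_funZ_subproof a (y + z); have h2 := L2_funD y z.
have h3 := L2_funD (L2_scale a y) (L2_scale a z).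
have h4 := L2_funZ_subproof a y; have h5 := L2_funZ_subproof a z.
near=> x => Sx.
by rewrite (near h1)// (near h2)// (near h3)// (near h4)// (near h5)// scalerDr.
Unshelve. all: by end_near. Qed.

Lemma L2_scaleDl (y : L2) : {morph L2_scale^~ y : a b / a + b}.
Proof.
move=> a b; apply/L2_eqP.
have h1 := L2_funZ_subproof (a + b) y.
have h2 := L2_funD (L2_scale a y) (L2_scale b y).
have h4 := L2_funZ_subproof a y; have h5 := L2_funZ_subproof b y.
near=> x => Sx.
by rewrite (near h1)// (near h2)// (near h4)// (near h5)// scalerDl.
Unshelve. all: by end_near. Qed.

HB.instance Definition _ := GRing.Zmodule_isLmodule.Build R L2
  L2_scaleA L2_scale1 L2_scaleDr L2_scaleDl.

Lemma L2_funZ a (y : L2) : L2_fun (a *: y) =ae (fun x => a *: L2_fun y x).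
Proof. exact: L2_funZ_subproof. Qed.

Definition L2_norm (y : L2) : R := Num.sqrt (fine (sqint w (L2_fun y))).

Lemma L2_normE y : L2_norm y = Num.sqrt (ip w (L2_fun y) (L2_fun y)).
Proof. by rewrite /L2_norm sqint_ip//; exact: L2_funP. Qed.

Lemma eq_ip f1 f2 g1 g2 : vmeasurable mu f1 -> vmeasurable mu f2 ->
  vmeasurable mu g1 -> vmeasurable mu g2 ->
  f1 =ae f2 -> g1 =ae g2 -> ip (n := n) w f1 g1 = ip w f2 g2.
Proof.
move=> mf1 mf2 mg1 mg2 f12 g12; rewrite /ip /Rintegral; congr fine.
apply: ae_eq_integral; first exact: supp_measurable.
- by apply/measurable_EFinP; exact: measurable_wdot.
- by apply/measurable_EFinP; exact: measurable_wdot.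
- by apply: filterS2 f12 g12 => x fx gx Sx; rewrite fx// gx.
Qed.

Lemma L2_norm_ae (y : L2) f : vmeasurable mu f -> L2_fun y =ae f ->
  L2_norm y = Num.sqrt (ip w f f).
Proof.
by move=> mf yf; rewrite L2_normE (eq_ip (L2_funP y).1 mf (L2_funP y).1 mf yf yf).
Qed.

Lemma L2_ler_normD (y z : L2) : L2_norm (y + z) <= L2_norm y + L2_norm z.
Proof.
have Ly := L2_funP y; have Lz := L2_funP z.
have Lyz := square_integrable_comb 1 Ly Lz.
rewrite (@L2_norm_ae (y + z) (1 *: L2_fun y + L2_fun z) Lyz.1); last first.
  by apply: filterS (L2_funD y z) => x /[apply] ->; rewrite !fctE scale1r.
rewrite ip_comb// (ipC _ (L2_fun y)) (ipC _ (L2_fun z)) !ip_comb// !L2_normE.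
rewrite (ipC _ (L2_fun z) (L2_fun y)).
set p := Num.sqrt (ip w (L2_fun y) _); set q := Num.sqrt (ip w (L2_fun z) _).
rewrite -[leRHS]ger0_norm ?addr_ge0 ?sqrtr_ge0// -sqrtr_sqr ler_sqrt ?sqr_ge0//.
rewrite sqrrD !sqr_sqrtr ?ip_ge0//.
have := ip_CS Ly Lz; rewrite -/p -/q ler_norml => /andP[_].
rewrite -mulr_natr; lra.
Qed.

Lemma L2_normrZ (a : R) (y : L2) : L2_norm (a *: y) = `|a| * L2_norm y.
Proof.
have Ly := L2_funP y.
have L0 : square_integrable w (0 : R -> 'cV[R]_n).
  by have := L2pred_submod w n; case; rewrite inE.
have La := square_integrable_comb a Ly L0; rewrite addr0 in La.
rewrite (L2_norm_ae La.1 (L2_funZ a y)) L2_normE.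
rewrite (_ : ip _ _ _ = a ^+ 2 * ip w (L2_fun y) (L2_fun y)).
  by rewrite sqrtrM ?sqr_ge0// sqrtr_sqr.
rewrite /ip -RintegralZl//; [|exact: supp_measurable|exact: sqint_integrable].
by apply: eq_Rintegral => x _; rewrite !fctE dotZl dotZr; ring.
Qed.

Lemma L2_norm0_eq0 (y : L2) : L2_norm y = 0 -> y = 0.
Proof.
have Ly := L2_funP y.
move=> /eqP; rewrite L2_normE sqrtr_eq0 => ip0.
have {}ip0 : ip w (L2_fun y) (L2_fun y) = 0 by apply/eqP; rewrite eq_le ip0 ip_ge0.
have := sqint_ip Ly; rewrite ip0 sqintE => int0.
have my := Ly.1.
have : ae_eq mu (supp mu) (fun x => (w x * dot (L2_fun y x) (L2_fun y x))%:E) (cst 0%E).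
  apply/(ae_eq_integral_abs mu (supp_measurable mu)).
    by apply/measurable_EFinP; exact: measurable_wdot.
  apply: etrans int0; apply: eq_integral => x; rewrite inE => Sx.
  by rewrite gee0_abs// lee_fin wdot_ge0.
move=> wy0; apply/eqP; rewrite -[y]reprK -(raddf0 \pi_L2) -Quotient.idealrBE inE subr0.
apply: filterS wy0 => x h Sx; apply: dot_eq0.
by have [/eqP] := h Sx; rewrite mulf_eq0 gt_eqF ?weight_gt0//= => /eqP.
Qed.

HB.instance Definition _ := Lmodule_isNormed.Build R L2
  L2_ler_normD L2_normrZ L2_norm0_eq0.

End L2_space.

Definition is_class_of (R : realType)
    (mu : {measure set (measurableTypeR R) -> \bar R}) (w : weight mu) n
    (y : L2 w n) (f : R -> 'cV[R]_n) : Prop :=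
  exists Lf : square_integrable w f, y = L2_class Lf.

Section embedding.
Context {R : realType} {mu : {measure set (measurableTypeR R) -> \bar R}}.
Context {n : nat}.
Implicit Types w : weight mu.

Lemma is_class_ofP w (y : L2 w n) f : is_class_of y f <->
  square_integrable w f /\ ae_eq mu (supp mu) (L2_fun y) f.
Proof.
split=> [[Lf ->]|[Lf yf]]; first by split=> //; exact: L2_classE.
exists Lf; apply/L2_eqP; apply: ae_eq_trans yf _.
exact/ae_eq_sym/L2_classE.
Qed.

Lemma square_integrable_le w1 w2 : (forall x, supp mu x -> w2 x <= w1 x) ->
  forall f : R -> 'cV[R]_n, square_integrable w1 f -> square_integrable w2 f.
Proof.
move=> w12 f [mf fi]; split=> //; apply: le_lt_trans fi; rewrite !sqintE.
apply: ge0_le_integral; first exact: supp_measurable.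
- by move=> x Sx; rewrite lee_fin wdot_ge0.
- by apply/measurable_EFinP; exact: measurable_wdot.
- by apply/measurable_EFinP; exact: measurable_wdot.
- by move=> x Sx; rewrite lee_fin ler_wpM2r ?dot_ge0// w12.
Qed.

Definition L2_incl w1 w2 (w12 : forall x, supp mu x -> w2 x <= w1 x)
  (y : L2 w1 n) : L2 w2 n := L2_class (square_integrable_le w12 (L2_funP y)).

End embedding.

Section kernel.
Context {R : realType}.

Definition completely_monotone (K : R -> R) : Prop :=
  forall (k : nat) (t : R), 0 < t ->
    derivable (derive1n k K) t 1 /\ 0 <= (-1) ^+ k * derive1n k K t.

(* A Radon measure on [0, oo[ is encoded as a Borel measure on R which is
   concentrated on [0, oo[ and finite on compact sets; regularity is automatic
   on the real line. *)
Definition radon_halfline (mu : {measure set (measurableTypeR R) -> \bar R}) :=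
  mu `]-oo, 0[%classic = 0%E /\
  forall A : set R, compact A -> (mu A < +oo)%E.

(* The value 1 at 0 is there because x `^ (- 2^-1) is 0, not +oo, at x = 0. *)
Definition min1_rsqrt (x : R) : R :=
  if x == 0 then 1 else Num.min 1 (x `^ (- 2^-1)).

Record kernel_assumption (K : R -> R)
    (mu : {measure set (measurableTypeR R) -> \bar R}) (r : R -> R) : Prop :=
  KernelAssumption {
    ker_cm : completely_monotone K ;
    ker_radon : radon_halfline mu ;
    ker_laplace : forall t : R, 0 < t ->
      (\int[mu]_(x in `[0%R, +oo[) (expR (- (x * t)))%:E = (K t)%:E)%E ;
    ker_r_noninc : forall x y : R, 0 <= x -> x <= y -> r y <= r x ;
    ker_r_meas : measurable_fun (`[0, +oo[%classic : set (measurableTypeR R)) r ;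
    ker_r_gt0 : forall x : R, 0 <= x -> 0 < r x ;
    ker_r_ge : forall x : R, 0 <= x -> min1_rsqrt x <= r x ;
    ker_r_le1 : forall x : R, 0 <= x -> r x <= 1 ;
    ker_r_int : (\int[mu]_(x in supp mu) (r x)%:E < +oo)%E }.

End kernel.

Section spaces.
Context {R : realType} {K : R -> R}.
Context {mu : {measure set (measurableTypeR R) -> \bar R}} {r : R -> R}.
Hypothesis h : kernel_assumption K mu r.

Lemma supp_ge0 x : supp mu x -> 0 <= x.
Proof.
move=> Sx; rewrite leNgt; apply/negP => x0.
have /Sx : open_nbhs x `]-oo, (0 : R)[%classic.
  by split; [by rewrite set_itvE; exact: open_lt|rewrite /= in_itv].
by rewrite (ker_radon h).1 ltxx.
Qed.

Lemma supp_r_meas : measurable_fun (supp mu : set (measurableTypeR R)) r.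
Proof.
apply: measurable_funS (ker_r_meas h); first exact: measurable_itv.
by move=> x /supp_ge0 x0; rewrite /= in_itv /= x0.
Qed.

Lemma supp_r_gt0 x : supp mu x -> 0 < r x.
Proof. by move=> /supp_ge0 x0; exact: (ker_r_gt0 h x0). Qed.

Lemma supp_x1_gt0 x : supp mu x -> 0 < x + 1.
Proof. by move=> /supp_ge0 ?; rewrite ltr_pwDr. Qed.

Lemma wV_meas :
  measurable_fun (supp mu : set (measurableTypeR R)) (fun x => (x + 1) * r x).
Proof. by apply: measurable_funM supp_r_meas; exact: measurable_funD. Qed.

Lemma wV_gt0 x : supp mu x -> 0 < (x + 1) * r x.
Proof. by move=> Sx; rewrite mulr_gt0 ?supp_r_gt0 ?supp_x1_gt0. Qed.

Lemma wVd_meas :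
  measurable_fun (supp mu : set (measurableTypeR R)) (fun x => (x + 1)^-1 * r x).
Proof.
apply: measurable_funM supp_r_meas.
apply: subspace_continuous_measurable_fun; first exact: supp_measurable.
apply: continuous_in_subspaceT => x; rewrite inE => Sx.
apply: cvgV; first by rewrite gt_eqF// supp_x1_gt0.
by apply: cvgD; [exact: cvg_id|exact: cvg_cst].
Qed.

Lemma wVd_gt0 x : supp mu x -> 0 < (x + 1)^-1 * r x.
Proof. by move=> Sx; rewrite mulr_gt0 ?supp_r_gt0 ?invr_gt0 ?supp_x1_gt0. Qed.

Definition wH := Weight supp_r_meas supp_r_gt0.
Definition wV := Weight wV_meas wV_gt0.
Definition wVd := Weight wVd_meas wVd_gt0.

Lemma wH_le_wV x : supp mu x -> wH x <= wV x.
Proof.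
move=> Sx /=; rewrite ler_peMl ?(ltW (supp_r_gt0 Sx))//.
by rewrite lerDr supp_ge0.
Qed.

Lemma wVd_le_wH x : supp mu x -> wVd x <= wH x.
Proof.
move=> Sx /=; rewrite ler_piMl ?(ltW (supp_r_gt0 Sx))//.
by rewrite invf_le1 ?supp_x1_gt0// lerDr supp_ge0.
Qed.

Definition Hmu n := L2 wH n.
Definition Vmu n := L2 wV n.
(* The dual of Vmu, through its identification with a space of functions. *)
Definition Vdmu n := L2 wVd n.

Definition VtoH n : Vmu n -> Hmu n := L2_incl wH_le_wV.
Definition HtoVd n : Hmu n -> Vdmu n := L2_incl wVd_le_wH.

Definition innerH n (y z : Hmu n) : R := ip wH (L2_fun y) (L2_fun z).

(* The continuous extension to Vdmu x Vmu of the inner product of Hmu: see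
   pairingE and pairing_bounded. *)
Definition pairing n (y' : Vdmu n) (y : Vmu n) : R :=
  ip wH (L2_fun y') (L2_fun y).

Lemma pairingE n (y' : Hmu n) (y : Vmu n) :
  pairing (HtoVd y') y = innerH y' (VtoH y).
Proof.
apply: eq_ip; [exact: (L2_funP _).1..| |].
- exact: L2_classE.
- exact/ae_eq_sym/L2_classE.
Qed.

Lemma pairing_bounded n (y' : Vdmu n) (y : Vmu n) :
  `|pairing y' y| <= `|y'| * `|y|.
Proof.
have mS := supp_measurable mu.
have Ly' := L2_funP y'; have Ly := L2_funP y.
pose g x := (x + 1) *: L2_fun y x.
have mg : vmeasurable mu g.
  move=> i; rewrite (_ : (fun x => _) = (fun x => (x + 1) * L2_fun y x i 0)).
    by apply: measurable_funM (Ly.1 i); exact: measurable_funD.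
  by apply/funext => x; rewrite mxE.
have gE x : supp mu x ->
    wVd x * dot (g x) (g x) = wV x * dot (L2_fun y x) (L2_fun y x).
  move=> Sx; have x0 := supp_x1_gt0 Sx.
  by rewrite /= dotZl dotZr; field; rewrite gt_eqF.
have Lg : square_integrable wVd g.
  split=> //; apply: le_lt_trans Ly.2; rewrite !sqintE le_eqVlt; apply/orP; left.
  by apply/eqP; apply: eq_integral => x; rewrite inE => Sx; rewrite gE.
have -> : pairing y' y = ip wVd (L2_fun y') g.
  apply: eq_Rintegral => x; rewrite inE => Sx; have x0 := supp_x1_gt0 Sx.
  by rewrite /= dotZr; field; rewrite gt_eqF.
apply: (le_trans (ip_CS Ly' Lg)).
rewrite (_ : ip wVd g g = ip wV (L2_fun y) (L2_fun y)); last first.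
  by apply: eq_Rintegral => x; rewrite inE => Sx; exact: gE.
by rewrite -!L2_normE.
Qed.

End spaces.

Section operators.
Context {R : realType}.

(* The second clause says that the operator norm is at most 1. *)
Definition linear_contraction (U V : normedModType R) (T : U -> V) : Prop :=
  linear T /\ forall y, `|T y| <= `|y|.

(* T is only meaningful at nonnegative times. *)
Record C0_semigroup (V : normedModType R) (T : R -> V -> V) : Prop :=
  C0Semigroup {
    C0_linear : forall t : R, 0 <= t -> linear (T t) ;
    C0_continuous : forall t : R, 0 <= t -> continuous (T t) ;
    C0_zero : forall y, T 0 y = y ;
    C0_add : forall (s t : R) y, 0 <= s -> 0 <= t -> T (s + t) y = T s (T t y) ;
    C0_strong : forall y, T t y @[t --> 0^'+] --> y }.

Definition generator_dom (V : normedModType R) (T : R -> V -> V) : set V :=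
  [set y | cvg (h^-1 *: (T h y - y) @[h --> 0^'+])].

Definition generator (V : normedModType R) (T : R -> V -> V) (y : V) : V :=
  lim (h^-1 *: (T h y - y) @[h --> 0^'+]).

(* d orthonormal vectors of R^d form a basis. *)
Definition orthonormal_basis d (e : 'I_d -> 'cV[R]_d) : Prop :=
  forall i j, dot (e i) (e j) = (i == j)%:R.

(* The value does not depend on the orthonormal basis e. Since the sum is finite,
   every linear operator on R^d is Hilbert-Schmidt. *)
Definition HS_norm (V : normedModType R) d (e : 'I_d -> 'cV[R]_d)
  (S : 'cV[R]_d -> V) : R := Num.sqrt (\sum_k `|S (e k)| ^+ 2).

End operators.

(* Main.v *)
(* Every operator involved is multiplication by a function m between weighted
   L^2 spaces, and it is bounded with norm at most c as soon as
   w2 m^2 <= c^2 w1 on the support. Dominated convergence then gives strong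
   continuity of the semigroup and, on {y : int theta^2 r |y|^2 < oo}, the
   convergence of the difference quotients, since
   0 <= (exp (- theta h) - 1) / h + theta <= min (theta, theta^2 h); Fatou's
   lemma gives the converse inclusion. The extension of A is unique because
   exp (- theta h) y lies in the domain of A for h > 0 and tends to y in V.
   For (iii), the Cauchy-Schwarz inequality gives
   (int |y|)^2 <= int w^-1 * int w |y|^2. The lower bound on r gives
   ((theta + 1) r)^-1 <= r, which settles w = (theta + 1) r, while for
   w = (eps (theta + 1) + M) r the factor int w^-1 tends to 0 as M tends to
   infinity. *)
Require Import Defs.
From HB Require Import structures.
From mathcomp Require Import all_boot all_order all_algebra.
From mathcomp Require Import all_classical all_reals all_analysis.
From mathcomp Require Import measurable_realfun ring lra.
Set Implicit Arguments.
Unset Strict Implicit.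
Unset Printing Implicit Defensive.
Import Order.TTheory GRing.Theory Num.Theory.
Import numFieldNormedType.Exports.
Local Open Scope classical_set_scope.
Local Open Scope ring_scope.

(** * Representatives of classes modulo equality almost everywhere *)

Section classes.
Context {R : realType} {mu : {measure set (measurableTypeR R) -> \bar R}}.
Context {n : nat}.
Implicit Types (w : weight mu) (f g : R -> 'cV[R]_n).

Lemma is_class_of_self w (y : L2 w n) : is_class_of y (L2_fun y).
Proof. by apply/is_class_ofP; split; [exact: L2_funP|exact: ae_eq_refl]. Qed.

Lemma is_class_of_comb w a (y z : L2 w n) f g :
  is_class_of y f -> is_class_of z g -> is_class_of (a *: y + z) (a *: f + g).
Proof.
move=> /is_class_ofP[Lf yf] /is_class_ofP[Lg zg]; apply/is_class_ofP; split.
  exact: square_integrable_comb.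
have h1 := L2_funD (a *: y) z; have h2 := L2_funZ a y.
near=> x => Sx.
by rewrite (near h1)// (near h2)// (near yf)// (near zg).
Unshelve. all: by end_near. Qed.

(** Equality is asked at every point of the support, not merely almost everywhere, so that
    measurability of [f] passes to [g]. *)
Lemma eq_is_class_of w (y : L2 w n) f g :
  (forall x, supp mu x -> f x = g x) -> is_class_of y f -> is_class_of y g.
Proof.
move=> fg /is_class_ofP[[mf fi] yf]; apply/is_class_ofP; split; last first.
  by apply: filterS yf => x h Sx; rewrite h// fg.
split=> [i|].
  by apply: eq_measurable_fun (mf i) => x /set_mem Sx; rewrite /= fg.
by apply: le_lt_trans fi; rewrite le_eqVlt; apply/orP; left; apply/eqP;
  apply: eq_integral => x /set_mem Sx; rewrite fg.
Qed.

(** Identities between operators are proved below in this way, by exhibiting one function that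
    represents both sides. *)
Lemma is_class_of_inj w (y z : L2 w n) f :
  is_class_of y f -> is_class_of z f -> y = z.
Proof.
move=> /is_class_ofP[_ yf] /is_class_ofP[_ zf]; apply/L2_eqP.
exact: ae_eq_trans yf (ae_eq_sym zf).
Qed.

(** Allows the representative chosen in one weighted space to serve in another: it agrees almost
    everywhere with the one of [z], so the two have the same [w2]-integral. *)
Lemma is_class_of_fun w1 w2 (y : L2 w1 n) (z : L2 w2 n) f :
  is_class_of y f -> is_class_of z f -> is_class_of z (L2_fun y).
Proof.
move=> /is_class_ofP[_ yf] /is_class_ofP[[_ fi] zf]; apply/is_class_ofP.
have my : vmeasurable mu (L2_fun y) := (L2_funP y).1.
split; last exact: ae_eq_trans zf (ae_eq_sym yf).
have [mz zi] := L2_funP z.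
split => //; apply: le_lt_trans zi; rewrite le_eqVlt; apply/orP; left; apply/eqP.
rewrite !sqintE; apply: ae_eq_integral; first exact: supp_measurable.
- by apply/measurable_EFinP; exact: measurable_wdot.
- by apply/measurable_EFinP; exact: measurable_wdot.
- have zy := ae_eq_trans zf (ae_eq_sym yf).
  by apply: filterS zy => x h Sx; rewrite h.
Qed.

Lemma is_class_of_norm w (y : L2 w n) f : is_class_of y f ->
  `|y| = Num.sqrt (ip w f f).
Proof. by move=> /is_class_ofP[[mf _] yf]; exact: L2_norm_ae. Qed.

Lemma is_class_of_sqr_norm w (y : L2 w n) f : is_class_of y f ->
  `|y| ^+ 2 = ip w f f.
Proof. by move=> /is_class_of_norm ->; rewrite sqr_sqrtr// ip_ge0. Qed.

Lemma is_class_of_incl w1 w2 (w12 : forall x, supp mu x -> w2 x <= w1 x)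
    (y : L2 w1 n) f :
  is_class_of y f -> is_class_of (L2_incl w12 y) f.
Proof.
move=> /is_class_ofP[Lf yf]; apply/is_class_ofP; split.
  exact: square_integrable_le w12 _ Lf.
by apply: ae_eq_trans yf; exact: L2_classE.
Qed.

End classes.

(** * Multiplication operators between weighted spaces *)

Section multipliers.
Context {R : realType} {mu : {measure set (measurableTypeR R) -> \bar R}}.
Implicit Types (w : weight mu) (c : R) (m : R -> R).

Definition multiplier w1 w2 c m :=
  measurable_fun (supp mu : set (measurableTypeR R)) m /\
  forall x, supp mu x -> w2 x * m x ^+ 2 <= c ^+ 2 * w1 x.

Context {n : nat}.
Implicit Types (f g : R -> 'cV[R]_n).

Local Notation mS := (supp_measurable mu).

Lemma vmeasurable_mul m f :
  measurable_fun (supp mu : set (measurableTypeR R)) m -> vmeasurable mu f ->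
  vmeasurable mu (fun x => m x *: f x).
Proof.
move=> mm mf i; rewrite (_ : (fun x => _) = (fun x => m x * f x i 0)).
  exact: measurable_funM mm (mf i).
by apply/funext => x; rewrite mxE.
Qed.

Lemma multiplier_dot_le w1 w2 c m f x : multiplier w1 w2 c m -> supp mu x ->
  w2 x * dot (m x *: f x) (m x *: f x) <= c ^+ 2 * (w1 x * dot (f x) (f x)).
Proof.
move=> [_ hm] Sx; rewrite dotZl dotZr !mulrA ler_wpM2r ?dot_ge0//.
by rewrite -mulrA -expr2 hm.
Qed.

Lemma square_integrable_mul w1 w2 c m f : multiplier w1 w2 c m ->
  square_integrable w1 f -> square_integrable w2 (fun x => m x *: f x).
Proof.
move=> hm Lf; have [mf fi] := Lf.
have mmf := vmeasurable_mul hm.1 mf.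
split=> //; rewrite sqintE.
apply: (@le_lt_trans _ _
  (\int[mu]_(x in supp mu) ((c ^+ 2)%:E * (w1 x * dot (f x) (f x))%:E))%E).
  apply: ge0_le_integral; first exact: mS.
  - by move=> x Sx; rewrite lee_fin (wdot_ge0 w2 (fun x => m x *: f x) Sx).
  - by apply/measurable_EFinP; exact: measurable_wdot.
  - by apply: measurable_funeM; apply/measurable_EFinP; exact: measurable_wdot.
  - by move=> x Sx; rewrite -EFinM lee_fin; exact: multiplier_dot_le.
apply: integrable_lty; first exact: mS.
by apply: integrableZl; [exact: mS|exact: sqint_integrable].
Qed.

Lemma ip_mul_le w1 w2 c m f : multiplier w1 w2 c m -> square_integrable w1 f ->
  ip w2 (fun x => m x *: f x) (fun x => m x *: f x) <= c ^+ 2 * ip w1 f f.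
Proof.
move=> hm Lf; have Lmf := square_integrable_mul hm Lf.
rewrite /ip -RintegralZl//; [|exact: mS|exact: sqint_integrable].
apply: le_Rintegral; first exact: mS.
- exact: sqint_integrable.
- exact: (integrableZl mS (c ^+ 2) (sqint_integrable Lf)).
- by move=> x Sx; exact: multiplier_dot_le.
Qed.

Definition L2_mul w1 w2 c m (hm : multiplier w1 w2 c m) (y : L2 w1 n) : L2 w2 n :=
  L2_class (square_integrable_mul hm (L2_funP y)).

Section L2_mul_theory.
Context w1 w2 c m (hm : multiplier w1 w2 c m).

Lemma is_class_of_mul (y : L2 w1 n) f : is_class_of y f ->
  is_class_of (L2_mul hm y) (fun x => m x *: f x).
Proof.
move=> /is_class_ofP[Lf yf]; apply/is_class_ofP; split.
  exact: square_integrable_mul hm Lf.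
apply: (ae_eq_trans (L2_classE _)).
by apply: filterS yf => x h Sx; rewrite h.
Qed.

Lemma L2_mulE (y : L2 w1 n) :
  is_class_of (L2_mul hm y) (fun x => m x *: L2_fun y x).
Proof. exact/is_class_of_mul/is_class_of_self. Qed.

Lemma L2_mul_linear : linear (L2_mul hm).
Proof.
move=> a y z; apply: is_class_of_inj (is_class_of_comb a (L2_mulE y) (L2_mulE z)).
apply: eq_is_class_of (is_class_of_mul
  (is_class_of_comb a (is_class_of_self y) (is_class_of_self z))) => x _.
by rewrite !fctE scalerDr !scalerA mulrC.
Qed.

Lemma ler_L2_mul (y : L2 w1 n) : 0 <= c -> `|L2_mul hm y| <= c * `|y|.
Proof.
move=> c0; rewrite (is_class_of_norm (L2_mulE y)).
rewrite (is_class_of_norm (is_class_of_self y)).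
rewrite -[c in leRHS]ger0_norm// -sqrtr_sqr -sqrtrM ?sqr_ge0//.
rewrite ler_sqrt; first exact: ip_mul_le (L2_funP y).
by rewrite mulr_ge0 ?sqr_ge0 ?ip_ge0.
Qed.

End L2_mul_theory.

(** Dominated convergence: as [c] does not depend on [k], all the integrands lie below the
    integrable function [c ^+ 2 * (w1 x * dot (f x) (f x))]. *)
Lemma ip_mul_cvg0 w1 w2 c (m : nat -> R -> R) f :
  (forall k, multiplier w1 w2 c (m k)) ->
  (forall x, supp mu x -> m k x @[k --> \oo] --> 0) ->
  square_integrable w1 f ->
  ip w2 (fun x => m k x *: f x) (fun x => m k x *: f x) @[k --> \oo] --> 0.
Proof.
move=> hm m0 Lf.
have Lmf k := square_integrable_mul (hm k) Lf.
have gi := integrableZl mS (c ^+ 2) (sqint_integrable Lf).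
apply: fine_cvg.
have := @dominated_cvg _ _ _ mu _ mS
  (fun k x => (w2 x * dot (m k x *: f x) (m k x *: f x))%:E) (cst 0%E) _ _ _ _ gi.
rewrite integral_cst ?mul0e; last exact: mS.
apply.
- move=> k; apply/measurable_EFinP.
  by apply: measurable_wdot; exact: (Lmf k).1.
- move=> x Sx; apply: cvg_EFin; first exact: nearW.
  rewrite [X in X @ _ --> _](_ : _ =
      fun k => (w2 x * dot (f x) (f x)) * m k x ^+ 2); last first.
    by apply/funext => k /=; rewrite dotZl dotZr; ring.
  rewrite (_ : 0 = w2 x * dot (f x) (f x) * (0 * 0)); last by rewrite !mulr0.
  by apply: cvgMr; under eq_fun do rewrite expr2; apply: cvgM; exact: m0.
- by [].
- move=> k x Sx /=; rewrite -EFinM lee_fin ger0_norm.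
    exact: multiplier_dot_le.
  exact: (wdot_ge0 w2 (fun x => m k x *: f x) Sx).
Qed.

(** The one-sided limit is tested on positive sequences tending to 0, because dominated convergence
    is a statement about sequences. The family [Y] is described through representatives only, so it
    need not be built with [L2_mul]. *)
Lemma L2_mul_cvg0 w1 w2 c (m : R -> R -> R) (y : L2 w1 n) (Y : R -> L2 w2 n) :
  (forall h, 0 < h -> multiplier w1 w2 c (m h)) ->
  (forall x, supp mu x -> m h x @[h --> 0^'+] --> 0) ->
  (forall h, 0 < h -> is_class_of (Y h) (fun x => m h x *: L2_fun y x)) ->
  Y h @[h --> 0^'+] --> 0.
Proof.
move=> hm m0 hY; apply/norm_cvg0P; apply/cvg_at_rightP => u [u0 ucvg].
rewrite -sqrtr0.
under eq_fun do rewrite (is_class_of_norm (hY _ (u0 _))).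
apply: continuous_cvg; first exact: sqrt_continuous.
apply: ip_mul_cvg0 (L2_funP y) => [k|x Sx]; first exact: hm (u0 k).
by have /cvg_at_rightP := m0 x Sx; apply.
Qed.

End multipliers.

(** * Integrability bounds *)

Section integrability.
Context {R : realType} {mu : {measure set (measurableTypeR R) -> \bar R}}.
Implicit Types (w : weight mu).

Local Notation mS := (supp_measurable mu).

Lemma measurable_weightV w :
  measurable_fun (supp mu : set (measurableTypeR R)) (fun x => (w x)^-1).
Proof.
(* The power with exponent -1 is measurable on the whole line and agrees with the inverse at the
   positive values taken by a weight. *)
apply: eq_measurable_fun (measurableT_comp (measurable_powR (-1)) (weight_meas w)).
by move=> x /set_mem Sx /=; rewrite powR_inv1// ltW// weight_gt0.
Qed.

Lemma measurable_enorm n (f : R -> 'cV[R]_n) : vmeasurable mu f ->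
  measurable_fun (supp mu : set (measurableTypeR R)) (fun x => enorm (f x)).
Proof.
move=> mf; rewrite (_ : (fun x => _) = Num.sqrt \o (fun x => dot (f x) (f x))).
  apply: measurableT_comp (measurable_dot mf mf).
  by apply: continuous_measurable_fun; exact: sqrt_continuous.
by apply/funext => x /=; rewrite -enorm_sqr sqrtr_sqr ger0_norm ?enorm_ge0.
Qed.

(* The Cauchy-Schwarz inequality for the splitting |f| = w |f| * w^-1. *)
Lemma weightV_integrable_bound w n (f : R -> 'cV[R]_n) :
  mu.-integrable (supp mu) (fun x => (w x)^-1%:E) -> square_integrable w f ->
  bochner_integrable mu f /\
  \int[mu]_(x in supp mu) enorm (f x) <=
    Num.sqrt (\int[mu]_(x in supp mu) (w x)^-1) * Num.sqrt (ip w f f).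
Proof.
move=> iw Lf; have [mf fi] := Lf.
(* The scalar functions [|f|] and [w^-1] are viewed as column vectors of size 1, so that [ip_CS]
   applies. The three weighted products are then [w |f|^2], [w^-1] and [|f|]. *)
pose F x : 'cV[R]_1 := const_mx (enorm (f x)).
pose G x : 'cV[R]_1 := const_mx (w x)^-1.
have dotE (a b : R) : dot (const_mx a : 'cV[R]_1) (const_mx b) = a * b.
  by rewrite /dot big_ord1 !mxE.
have FFE x : dot (F x) (F x) = dot (f x) (f x) by rewrite dotE -expr2 enorm_sqr.
have mF : vmeasurable mu F.
  move=> i; under eq_fun do rewrite mxE.
  exact: measurable_enorm.
have mG : vmeasurable mu G.
  move=> i; under eq_fun do rewrite mxE.
  exact: measurable_weightV.
have LF : square_integrable w F.
  split=> //; rewrite sqintE; under eq_integral do rewrite FFE.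
  by rewrite -sqintE.
have wGE x : supp mu x -> w x * dot (G x) (G x) = (w x)^-1.
  by move=> /(weight_gt0 w) w0; rewrite dotE mulrA divff ?mul1r// gt_eqF.
have LG : square_integrable w G.
  split=> //; rewrite sqintE; apply: le_lt_trans (integrable_lty mS iw).
  rewrite le_eqVlt; apply/orP; left; apply/eqP.
  by apply: eq_integral => x /set_mem Sx; rewrite wGE.
have wFG x : supp mu x -> w x * dot (F x) (G x) = enorm (f x).
  by move=> /(weight_gt0 w) w0; rewrite dotE mulrCA divff ?mulr1// gt_eqF.
split.
  split=> //; apply: eq_integrable (ip_integrable LF LG); first exact: mS.
  by move=> x /set_mem Sx; rewrite wFG.
have := ip_CS LF LG; rewrite [ip w F F](_ : _ = ip w f f); last first.
  by apply: eq_Rintegral => x _; rewrite FFE.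
rewrite [ip w G G](_ : _ = \int[mu]_(x in supp mu) (w x)^-1); last first.
  by apply: eq_Rintegral => x /set_mem Sx; exact: wGE.
rewrite [ip w F G](_ : _ = \int[mu]_(x in supp mu) enorm (f x)); last first.
  by apply: eq_Rintegral => x /set_mem Sx; exact: wFG.
by rewrite mulrC => /(le_trans (ler_norm _)).
Qed.

End integrability.

(** * Constant vectors and matrices in H, and integrability of the elements of V *)

Section kernel_bounds.
Context {R : realType} {K : R -> R}.
Context {mu : {measure set (measurableTypeR R) -> \bar R}} {r : R -> R}.
Hypothesis hK : kernel_assumption K mu r.

Local Notation mS := (supp_measurable mu).

Lemma kernel_weight_integrable : mu.-integrable (supp mu) (fun x => (r x)%:E).
Proof.
apply/integrableP; split; first by apply/measurable_EFinP; exact: supp_r_meas hK.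
apply: le_lt_trans (ker_r_int hK); rewrite le_eqVlt; apply/orP; left; apply/eqP.
by apply: eq_integral => x /set_mem Sx; rewrite gee0_abs// lee_fin ltW// (supp_r_gt0 hK).
Qed.

(* This is where the lower bound on [r] enters. *)
Lemma wV_inv_le x : supp mu x -> ((x + 1) * r x)^-1 <= r x.
Proof.
move=> Sx; have x0 := supp_ge0 hK Sx; have r0 := supp_r_gt0 hK Sx.
have x1 := supp_x1_gt0 hK Sx.
suff : (x + 1)^-1 <= r x * r x.
  rewrite -[leLHS]mul1r ler_pdivrMr// -[X in _ -> X <= _]mul1r.
  by rewrite ler_pdivrMr ?mulr_gt0// mulrCA mulrA mulrC mulrA.
have := ker_r_ge hK x0; rewrite /min1_rsqrt; have [->|xN0] := eqVneq x 0.
  (* At 0 both [(x + 1)^-1] and the lower bound on [r] equal 1. *)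
  by rewrite add0r invr1 => r1; rewrite -[1]mulr1 ler_pM.
have {xN0}x0 : 0 < x by rewrite lt_neqAle eq_sym xN0.
rewrite ge_min => /orP[r1|].
  apply: (@le_trans _ _ 1); first by rewrite invf_le1// lerDr ltW.
  by rewrite -[1]mulr1 ler_pM.
(* Here [r x * r x] is at least [x^-1], which exceeds [(x + 1)^-1]. *)
move=> rx; apply: (@le_trans _ _ ((x `^ (- 2^-1)) * (x `^ (- 2^-1)))).
  rewrite -powRD; last by rewrite (gt_eqF x0) implybT.
  rewrite [X in x `^ X](_ : _ = -1); last by field.
  by rewrite powR_inv1 ?(ltW x0)// lef_pV2 ?posrE// lerDl.
by rewrite ler_pM ?powR_ge0.
Qed.

Lemma measurable_cst_cV n (b : 'cV[R]_n) : vmeasurable mu (fun=> b).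
Proof. by move=> i; exact: measurable_cst. Qed.

Lemma square_integrable_cst n (b : 'cV[R]_n) :
  square_integrable (wH hK) (fun=> b).
Proof.
split; first exact: measurable_cst_cV.
have := integrableZl mS (enorm b ^+ 2) kernel_weight_integrable.
move=> /(integrable_lty mS); congr (_ < _)%E.
by apply: eq_integral => x _; rewrite -EFinM mulrC.
Qed.

Lemma is_class_of_cst_norm n (b : 'cV[R]_n) (y : Hmu hK n) :
  is_class_of y (fun=> b) ->
  `|y| = Num.sqrt (\int[mu]_(x in supp mu) r x) * enorm b.
Proof.
move=> /is_class_of_norm ->.
rewrite -[enorm b]ger0_norm ?enorm_ge0// -sqrtr_sqr -sqrtrM; last first.
  by apply: Rintegral_ge0 => x Sx; rewrite ltW// (supp_r_gt0 hK).
congr Num.sqrt; rewrite mulrC -RintegralZl//; [|exact: mS|exact: kernel_weight_integrable].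
by apply: eq_Rintegral => x _; rewrite mulrC enorm_sqr.
Qed.

(** The sum is the squared Frobenius norm of [sigma *m E], where [E] has the vectors [e k] as
    columns. Since that norm is the trace of [A *m A^T], the orthogonal matrix [E] cancels. *)
Lemma HS_norm_enorm n d (sigma : 'M[R]_(n, d)) (e : 'I_d -> 'cV[R]_d) :
  orthonormal_basis e -> \sum_k enorm (sigma *m e k) ^+ 2 = enorm sigma ^+ 2.
Proof.
move=> he; pose E : 'M[R]_d := \matrix_(i, j) e j i 0.
have EE : E *m E^T = 1%:M.
  (* Orthonormality of the columns gives [E^T *m E = 1]; the product commutes because [E] is
     square. *)
  apply: mulmx1C; apply/matrixP => i j; rewrite !mxE -he /dot.
  by apply: eq_bigr => k _; rewrite !mxE.
have sqrE m p (A : 'M[R]_(m, p)) : enorm A ^+ 2 = \tr (A *m A^T).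
  rewrite sqr_sqrtr; last first.
    by apply: sumr_ge0 => i _; apply: sumr_ge0 => j _; exact: sqr_ge0.
  apply: eq_bigr => i _; rewrite !mxE.
  by apply: eq_bigr => j _; rewrite !mxE expr2.
have -> : \sum_k enorm (sigma *m e k) ^+ 2 = enorm (sigma *m E) ^+ 2.
  rewrite [in RHS]/enorm sqr_sqrtr; last first.
    by apply: sumr_ge0 => i _; apply: sumr_ge0 => j _; exact: sqr_ge0.
  rewrite exchange_big; apply: eq_bigr => k _; rewrite enorm_sqr.
  apply: eq_bigr => i _; rewrite !mxE -expr2; congr (_ ^+ 2).
  by apply: eq_bigr => j _; rewrite !mxE.
by rewrite !sqrE trmx_mul mulmxA -(mulmxA sigma) EE mulmx1.
Qed.

Definition cst_class n (b : 'cV[R]_n) : Hmu hK n :=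
  L2_class (square_integrable_cst b).

Lemma cst_classE n (b : 'cV[R]_n) : is_class_of (cst_class b) (fun=> b).
Proof. by exists (square_integrable_cst b). Qed.

Lemma cst_class_linear n : linear (@cst_class n).
Proof.
move=> a b c; apply: is_class_of_inj (cst_classE _) _.
exact: is_class_of_comb (cst_classE b) (cst_classE c).
Qed.

(** By linearity the map is a finite sum of coordinate functions times the fixed vectors
    [S (delta_mx j 0)], and coordinates are continuous. *)
Lemma cst_class_mul_continuous n d (sigma : 'M[R]_(n, d)) :
  continuous (fun v => cst_class (sigma *m v)).
Proof.
pose S v := cst_class (sigma *m v).
have SE : S = fun v => \sum_j v j 0 *: S (delta_mx j 0).
  apply/funext => v.
  have L : linear S by move=> a b c; rewrite /S linearP cst_class_linear.
  pose HL := GRing.isLinear.Build _ _ _ _ S L.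
  pose T : {linear 'cV[R]_d -> Hmu hK n} := HB.pack S HL.
  rewrite -[S]/(T : _ -> _) {1}[v]matrix_sum_delta linear_sum.
  by apply: eq_bigr => j _; rewrite big_ord1 linearZ.
rewrite -/S SE; apply: continuous_big => [|j _ v]; first exact: add_continuous.
apply: (@cvgZr_tmp _ _ _ _ _ (fun u : 'cV[R]_d => u j 0)).
  exact: (@nbhs_filter _ v).
exact: coord_continuous.
Qed.

(** * Interpolation between the norms of V and H *)

Section mixed_weight.
Context (eps M : R) (eps0 : 0 < eps) (M0 : 0 < M).

Lemma mixed_weight_meas : measurable_fun (supp mu : set (measurableTypeR R))
  (fun x => (eps * (x + 1) + M) * r x).
Proof.
apply: measurable_funM (supp_r_meas hK).
by apply: measurable_funD => //; apply: measurable_funM => //; exact: measurable_funD.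
Qed.

Lemma mixed_weight_gt0 x : supp mu x -> 0 < (eps * (x + 1) + M) * r x.
Proof.
by move=> Sx; rewrite mulr_gt0 ?(supp_r_gt0 hK)// addr_gt0// mulr_gt0// (supp_x1_gt0 hK).
Qed.

Definition mixed_weight := Weight mixed_weight_meas mixed_weight_gt0.

(** Dropping [M] from the weight reduces this to [wV_inv_le]. The bound is uniform in [M], hence
    dominates the integrand as [M] grows. *)
Lemma mixed_weightV_le x : supp mu x -> (mixed_weight x)^-1 <= eps^-1 * r x.
Proof.
move=> Sx; apply: le_trans (ler_wpM2l _ (wV_inv_le Sx)); last by rewrite invr_ge0 ltW.
rewrite -invfM lef_pV2 ?posrE ?mixed_weight_gt0 ?mulr_gt0 ?(supp_r_gt0 hK) ?(supp_x1_gt0 hK)//.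
rewrite mulrA ler_wpM2r ?lerDl; first by [].
  exact/ltW/(supp_r_gt0 hK).
exact: ltW.
Qed.

Lemma mixed_weightV_integrable :
  mu.-integrable (supp mu) (fun x => (mixed_weight x)^-1%:E).
Proof.
apply: (le_integrable mS _ _ (integrableZl mS eps^-1 kernel_weight_integrable)).
  by apply/measurable_EFinP; exact: measurable_weightV.
move=> x Sx; rewrite -EFinM !abse_EFin lee_fin ger0_norm.
  exact: le_trans (mixed_weightV_le Sx) (ler_norm _).
by rewrite invr_ge0 ltW// mixed_weight_gt0.
Qed.

(** The constant comes from [eps * (x + 1) + M <= (eps + M) * (x + 1)], valid since [x + 1] is at
    least 1. *)
Lemma mixed_multiplier :
  multiplier (wV hK) mixed_weight (Num.sqrt (eps + M)) (cst 1).
Proof.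
split=> // x Sx; have x0 := supp_ge0 hK Sx.
rewrite expr1n mulr1 sqr_sqrtr /=; last by rewrite addr_ge0// ltW.
rewrite mulrA ler_wpM2r; [by []|exact/ltW/(supp_r_gt0 hK)|].
by rewrite mulrDl lerD2l ler_pMr// lerDr.
Qed.

Lemma ip_mixed_weight n (f : R -> 'cV[R]_n) : square_integrable (wV hK) f ->
  square_integrable mixed_weight f /\
  ip mixed_weight f f = eps * ip (wV hK) f f + M * ip (wH hK) f f.
Proof.
move=> Lf; have LH := square_integrable_le (wH_le_wV hK) Lf; split.
  have := square_integrable_mul mixed_multiplier Lf; congr square_integrable.
  by apply/funext => x; rewrite scale1r.
rewrite /ip -!RintegralZl//; [|exact: mS|exact: sqint_integrable|exact: mS|
  exact: sqint_integrable].
rewrite -RintegralD//; [|exact: mS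
  |exact: (integrableZl mS eps (sqint_integrable Lf))
  |exact: (integrableZl mS M (sqint_integrable LH))].
by apply: eq_Rintegral => x _ /=; ring.
Qed.

End mixed_weight.

(** Dominated convergence along [M = k + 1], the shift keeping [M] positive. The threshold 1
    suffices because [eps] is already part of the weight. *)
Lemma mixed_weightV_vanishes (eps : R) (eps0 : 0 < eps) :
  exists M : R, exists M0 : 0 < M,
    \int[mu]_(x in supp mu) (mixed_weight eps0 M0 x)^-1 <= 1.
Proof.
have k0 (k : nat) : 0 < k.+1%:R :> R by [].
have gi := integrableZl mS eps^-1 kernel_weight_integrable.
have h : \int[mu]_(x in supp mu) (mixed_weight eps0 (k0 k) x)^-1
    @[k --> \oo] --> 0.
  apply: fine_cvg.
  have := @dominated_cvg _ _ _ mu _ mS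
    (fun k x => (mixed_weight eps0 (k0 k) x)^-1%:E) (cst 0%E) _ _ _ _ gi.
  rewrite integral_cst ?mul0e; last exact: mS.
  apply=> //.
  - by move=> k; apply/measurable_EFinP; exact: measurable_weightV.
  - move=> x Sx; apply: cvg_EFin; first exact: nearW.
    have r0 := supp_r_gt0 hK Sx; have x1 := supp_x1_gt0 hK Sx.
    (* At a fixed point the weight is at least [M * r x], with [M = k + 1]. *)
    apply: (@squeeze_cvgr _ _ _ _ (cst 0) (fun k => k.+1%:R^-1 * (r x)^-1)).
    + apply: nearW => k; rewrite invr_ge0 ltW ?mixed_weight_gt0//=.
      rewrite -invfM lef_pV2 ?posrE ?mulr_gt0 ?addr_gt0 ?mulr_gt0//.
      by rewrite ler_pM2r// lerDr mulr_ge0// ltW.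
    + exact: cvg_cst.
    + rewrite -(mul0r (r x)^-1); apply: cvgMl; exact: cvg_harmonic.
  - move=> k x Sx; rewrite -EFinM !abse_EFin lee_fin ger0_norm.
      exact: mixed_weightV_le.
    by rewrite invr_ge0 ltW// mixed_weight_gt0.
have /cvgr_le/(_ 1 ltr01)[N _ /(_ N (leqnn N)) hN] := h.
by exists N.+1%:R, (k0 N).
Qed.

Lemma Vmu_integrable n (y : Vmu hK n) : bochner_integrable mu (L2_fun y) /\
  \int[mu]_(x in supp mu) enorm (L2_fun y x) <=
    Num.sqrt (\int[mu]_(x in supp mu) r x) * `|y|.
Proof.
have wVi : mu.-integrable (supp mu) (fun x => (wV hK x)^-1%:E).
  apply: (le_integrable mS _ _ kernel_weight_integrable).
    by apply/measurable_EFinP; exact: measurable_weightV.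
  move=> x Sx; rewrite !abse_EFin lee_fin ger0_norm.
    exact: le_trans (wV_inv_le Sx) (ler_norm _).
  by rewrite invr_ge0 ltW// weight_gt0.
have [hi hle] := weightV_integrable_bound wVi (L2_funP y); split=> //.
apply: le_trans hle _; rewrite (is_class_of_norm (is_class_of_self y)).
rewrite ler_wpM2r ?sqrtr_ge0// ler_sqrt; last first.
  by apply: Rintegral_ge0 => x Sx; rewrite ltW// (supp_r_gt0 hK).
apply: le_Rintegral wVi kernel_weight_integrable _; first exact: mS.
by move=> x Sx; exact: wV_inv_le.
Qed.

Lemma Vmu_interpolation (eps : R) : 0 < eps -> exists2 M : R, 0 < M &
  forall n (y : Vmu hK n),
    (\int[mu]_(x in supp mu) enorm (L2_fun y x)) ^+ 2 <=
      eps * `|y| ^+ 2 + M * `|VtoH y| ^+ 2.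
Proof.
move=> eps0; have [M [M0 hM]] := mixed_weightV_vanishes eps0.
(* [M] is fixed before the dimension and the function are introduced. *)
exists M => // n y; have hy := is_class_of_self y.
rewrite (is_class_of_sqr_norm hy).
rewrite (is_class_of_sqr_norm (is_class_of_incl (wH_le_wV hK) hy)).
have [Lm <-] := ip_mixed_weight eps0 M0 (L2_funP y).
have [_ hle] := weightV_integrable_bound (mixed_weightV_integrable eps0 M0) Lm.
rewrite -[leRHS]sqr_sqrtr ?ip_ge0// ler_sqr ?nnegrE ?sqrtr_ge0//; last first.
  by apply: Rintegral_ge0 => x _; exact: enorm_ge0.
apply: le_trans hle _; rewrite ler_piMl ?sqrtr_ge0//.
by rewrite -sqrtr1 ler_sqrt.
Qed.

End kernel_bounds.

(** * The semigroup *)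

Section exponential_bounds.
Context {R : realType}.
Implicit Type t : R.

Lemma expRN_le1 t : 0 <= t -> expR (- t) <= 1.
Proof. by move=> t0; rewrite -expR0 ler_expR oppr_le0. Qed.

Lemma expRN_le_inv t : 0 <= t -> expR (- t) <= (1 + t)^-1.
Proof.
by move=> t0; rewrite expRN lef_pV2 ?posrE ?expR_gt0 ?expR_ge1Dx// ltr_pwDl.
Qed.

(** The quadratic bound follows from [expR (- t) <= (1 + t)^-1], since [(1 + t)^-1 - 1 + t] equals
    [t ^+ 2 / (1 + t)]. *)
Lemma expRN_taylor1 t : 0 <= t ->
  [/\ 0 <= expR (- t) - 1 + t, expR (- t) - 1 + t <= t &
      expR (- t) - 1 + t <= t ^+ 2].
Proof.
move=> t0; have h1 := expRN_le1 t0; have h2 := expR_ge1Dx (- t).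
split; [lra|lra|].
have t1 : 0 < 1 + t by rewrite ltr_pwDl.
apply: (@le_trans _ _ ((1 + t)^-1 - 1 + t)).
  by rewrite !lerD2r expRN_le_inv.
rewrite [leLHS](_ : _ = t ^+ 2 * (1 + t)^-1); last by field; rewrite gt_eqF.
by rewrite ler_piMr ?sqr_ge0// invf_le1// lerDl.
Qed.

End exponential_bounds.

Section contraction.
Context {R : realType} {U V : normedModType R}.

Lemma linear_contraction_continuous (T : U -> V) :
  linear_contraction T -> continuous T.
Proof.
move=> [linT leT] y; apply/cvgrPdist_lt => e e0.
have TB z : T y - T z = T (y - z).
  by rewrite [y - z]addrC -[- z]scaleN1r linT scaleN1r addrC.
near=> z; rewrite TB; apply: le_lt_trans (leT _) _.
by near: z; apply: (cvgr_dist_lt (fun z => z)) e0 => /=.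
Unshelve. all: by end_near. Qed.

End contraction.

Section decay.
Context {R : realType} {K : R -> R}.
Context {mu : {measure set (measurableTypeR R) -> \bar R}} {r : R -> R}.
Hypothesis hK : kernel_assumption K mu r.
Implicit Types w : weight mu.

Lemma measurable_decay t :
  measurable_fun (supp mu : set (measurableTypeR R)) (fun x => expR (- (x * t))).
Proof.
apply: measurableT_comp => //; apply: measurableT_comp => //.
by apply: measurable_funM.
Qed.

Lemma decay_multiplier w t : 0 <= t ->
  multiplier w w 1 (fun x => expR (- (x * t))).
Proof.
move=> t0; split; first exact: measurable_decay.
move=> x Sx; have x0 := supp_ge0 hK Sx.
rewrite expr1n mul1r ler_piMr ?(ltW (weight_gt0 _ Sx))//.
by rewrite exprn_ile1 ?expR_ge0// expRN_le1 ?mulr_ge0.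
Qed.

Lemma max0_ge0 (t : R) : 0 <= Num.max t 0.
Proof. by rewrite le_max lexx orbT. Qed.

(* Truncated at negative times, where the multiplier would be unbounded. *)
Definition decay w n (t : R) : L2 w n -> L2 w n :=
  L2_mul (decay_multiplier w (max0_ge0 t)).

Lemma is_class_of_decay w n t (y : L2 w n) f : 0 <= t -> is_class_of y f ->
  is_class_of (decay t y) (fun x => expR (- (x * t)) *: f x).
Proof.
move=> t0 yf; apply: eq_is_class_of (is_class_of_mul _ yf) => x _.
by rewrite max_l.
Qed.

Lemma decay_contraction w n t : linear_contraction (@decay w n t).
Proof.
split; first exact: L2_mul_linear.
by move=> y; rewrite -[leRHS]mul1r; exact: ler_L2_mul.
Qed.

(** The multiplier [expR (- (x * t)) - 1] has absolute value at most 1 on the support and tends to 0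
    pointwise. The weight is arbitrary, since strong continuity is needed in H for the semigroup and
    in V for the uniqueness of the extension. *)
Lemma decay_cvg w n (y : L2 w n) : decay t y @[t --> 0^'+] --> y.
Proof.
apply/subr_cvg0.
apply: (@L2_mul_cvg0 _ _ _ w w 1 (fun t x => expR (- (x * t)) - 1) y).
- move=> h h0; split.
    by apply: measurable_funB (measurable_decay h) _.
  move=> x Sx; have x0 := supp_ge0 hK Sx.
  rewrite expr1n mul1r ler_piMr ?(ltW (weight_gt0 _ Sx))//.
  rewrite /= -sqrrN opprB exprn_ile1//.
  by rewrite subr_ge0 expRN_le1// mulr_ge0// ltW.
- move=> x Sx; have x0 := supp_ge0 hK Sx.
  have e1 : expR (- (x * t)) @[t --> 0^'+] --> expR (- (x * 0)).
    apply: cvg_at_right_filter.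
    apply: (@cvg_comp _ _ _ (fun t => - (x * t)) expR _ (nbhs (- (x * 0)))).
      by apply: cvgN; apply: cvgMr; exact: cvg_id.
    exact: continuous_expR.
  rewrite mulr0 oppr0 expR0 in e1.
  by rewrite -[X in _ --> X](subrr (1 : R)); apply: cvgB e1 (cvg_cst _).
- move=> h h0; rewrite addrC -scaleN1r.
  apply: eq_is_class_of (is_class_of_comb (-1) (is_class_of_self y)
    (is_class_of_decay (ltW h0) (is_class_of_self y))) => x _.
  by rewrite !fctE scaleN1r scalerBl scale1r addrC.
Qed.

Lemma decay_C0 w n : C0_semigroup (@decay w n).
Proof.
split.
- by move=> t _; have [] := @decay_contraction w n t.
- by move=> t _; exact/linear_contraction_continuous/decay_contraction.
- move=> y; apply: is_class_of_inj (is_class_of_self y).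
  apply: eq_is_class_of (is_class_of_decay (lexx 0) (is_class_of_self y)) => x _.
  by rewrite mulr0 oppr0 expR0 scale1r.
- move=> s t y s0 t0; have hy := is_class_of_self y.
  apply: is_class_of_inj (is_class_of_decay s0 (is_class_of_decay t0 hy)).
  apply: eq_is_class_of (is_class_of_decay (addr_ge0 s0 t0) hy) => x _.
  by rewrite scalerA -expRD mulrDr opprD.
- exact: decay_cvg.
Qed.

End decay.

(** * The generator *)

Section generator.
Context {R : realType} {K : R -> R}.
Context {mu : {measure set (measurableTypeR R) -> \bar R}} {r : R -> R}.
Hypothesis hK : kernel_assumption K mu r.
Context {n : nat}.

Local Notation mS := (supp_measurable mu).
Local Notation T := (@decay _ _ _ _ hK (wH hK) n).

Lemma wD_meas : measurable_fun (supp mu : set (measurableTypeR R))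
  (fun x => (x + 1) ^+ 2 * r x).
Proof.
apply: measurable_funM (supp_r_meas hK).
by apply: measurable_funX; exact: measurable_funD.
Qed.

Lemma wD_gt0 x : supp mu x -> 0 < (x + 1) ^+ 2 * r x.
Proof.
by move=> Sx; rewrite mulr_gt0 ?exprn_gt0 ?(supp_r_gt0 hK) ?(supp_x1_gt0 hK).
Qed.

(* A weight whose norm is equivalent to the graph norm of the generator. *)
Definition wD := Weight wD_meas wD_gt0.

Lemma wV_le_wD x : supp mu x -> wV hK x <= wD x.
Proof.
move=> Sx; have x0 := supp_ge0 hK Sx; have r0 := supp_r_gt0 hK Sx.
by rewrite /= ler_pM2r// expr2 ler_peMl ?addr_ge0// lerDr.
Qed.

Lemma measurable_sqr_wdot (f : R -> 'cV[R]_n) : vmeasurable mu f ->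
  measurable_fun (supp mu : set (measurableTypeR R))
    (fun x => x ^+ 2 * r x * enorm (f x) ^+ 2).
Proof.
move=> mf; apply: measurable_funM.
  by apply: measurable_funM (supp_r_meas hK); exact: measurable_funX.
by apply: measurable_funX; exact: measurable_enorm.
Qed.

(** On the support, [x ^+ 2 <= (x + 1) ^+ 2 <= 2 * (1 + x ^+ 2)]; in the upper bound the summand 1
    is paid for by the norm in H. *)
Lemma square_integrable_wDP (f : R -> 'cV[R]_n) : square_integrable (wH hK) f ->
  square_integrable wD f <->
  (\int[mu]_(x in supp mu) (x ^+ 2 * r x * enorm (f x) ^+ 2)%:E < +oo)%E.
Proof.
move=> Lf; have [mf fi] := Lf.
have p0 x : supp mu x -> 0 <= r x * enorm (f x) ^+ 2.
  by move=> Sx; rewrite mulr_ge0 ?sqr_ge0// ltW// (supp_r_gt0 hK).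
have q0 x : supp mu x -> 0 <= x ^+ 2 * r x * enorm (f x) ^+ 2.
  by move=> Sx; rewrite -mulrA mulr_ge0 ?sqr_ge0 ?p0.
have mq : measurable_fun (supp mu : set (measurableTypeR R))
    (EFin \o (fun x => x ^+ 2 * r x * enorm (f x) ^+ 2)).
  by apply/measurable_EFinP; exact: measurable_sqr_wdot.
have mD : measurable_fun (supp mu : set (measurableTypeR R))
    (fun x => (wD x * enorm (f x) ^+ 2)%:E).
  apply/measurable_EFinP; apply: measurable_funM (weight_meas wD) _.
  by apply: measurable_funX; exact: measurable_enorm.
split=> [[_]|qi].
  apply: le_lt_trans; apply: ge0_le_integral => //; first exact: mS.
  move=> x Sx; rewrite lee_fin /= -[leLHS]mulrA -[leRHS]mulrA ler_wpM2r ?p0//.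
  by have := supp_ge0 hK Sx => x0; rewrite ler_sqr ?nnegrE ?addr_ge0// lerDl.
split=> //.
have iq : mu.-integrable (supp mu)
    (fun x => (x ^+ 2 * r x * enorm (f x) ^+ 2)%:E).
  apply/integrableP; split => //; apply: le_lt_trans qi.
  rewrite le_eqVlt; apply/orP; left; apply/eqP.
  by apply: eq_integral => x /set_mem Sx; rewrite gee0_abs// lee_fin q0.
have ip := sqint_integrable Lf.
have := integrableD mS (integrableZl mS 2 ip) (integrableZl mS 2 iq).
move=> /(integrable_lty mS); apply: le_lt_trans.
apply: ge0_le_integral => //; first exact: mS.
- by move=> x Sx; rewrite lee_fin mulr_ge0 ?sqr_ge0// ltW// weight_gt0.
- apply: emeasurable_funD; apply: measurable_funeM => //.
  by apply/measurable_EFinP; exact: measurable_wdot.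
- move=> x Sx; rewrite -!EFinM -EFinD lee_fin -enorm_sqr.
  rewrite [leRHS](_ : _ = 2 * (1 + x ^+ 2) * (r x * enorm (f x) ^+ 2)); last by rewrite /=; ring.
  rewrite /= -mulrA ler_wpM2r ?p0//.
  by have := sqr_ge0 (x - 1); rewrite -subr_ge0 => h; nra.
Qed.

Definition difference_quotient (h x : R) := h^-1 * (expR (- (x * h)) - 1).

Lemma measurable_difference_quotient h :
  measurable_fun (supp mu : set (measurableTypeR R)) (difference_quotient h).
Proof.
apply: measurable_funM => //.
by apply: measurable_funB => //; exact: measurable_decay.
Qed.

(** These are the bounds of [expRN_taylor1] at [x * h], divided by [h]. The bound by [x] is uniform
    in [h] and gives domination; the last one gives the pointwise limit. *)
Lemma difference_quotient_bound h x : 0 < h -> 0 <= x ->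
  [/\ 0 <= difference_quotient h x + x, difference_quotient h x + x <= x &
      difference_quotient h x + x <= x ^+ 2 * h].
Proof.
move=> h0 x0; have [a b c] := expRN_taylor1 (mulr_ge0 x0 (ltW h0)).
have -> : difference_quotient h x + x = h^-1 * (expR (- (x * h)) - 1 + x * h).
  by rewrite /difference_quotient; field; rewrite gt_eqF.
split; first by rewrite mulr_ge0// invr_ge0 ltW.
  by rewrite mulrC ler_pdivrMr.
by rewrite mulrC ler_pdivrMr//; apply: le_trans c _; rewrite exprMn [h ^+ 2]expr2 mulrA.
Qed.

Lemma difference_quotient_cvg x : 0 <= x ->
  difference_quotient h x @[h --> 0^'+] --> - x.
Proof.
move=> x0; apply/subr_cvg0.
apply: (@squeeze_cvgr _ _ _ _ (cst 0) (fun h => x ^+ 2 * h)).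
- near=> h; have h0 : 0 < h by [].
  by rewrite opprK; have [-> _ ->] := difference_quotient_bound h0 x0.
- exact: cvg_cst.
- apply: cvg_at_right_filter; rewrite -[X in _ --> X](mulr0 (x ^+ 2)).
  by apply: cvgMr; exact: cvg_id.
Unshelve. all: by end_near. Qed.

Lemma is_class_of_quotient h (y : Hmu hK n) f : 0 < h -> is_class_of y f ->
  is_class_of (h^-1 *: (T h y - y)) (fun x => difference_quotient h x *: f x).
Proof.
move=> h0 hy; have hTy := is_class_of_decay hK (ltW h0) hy.
have h1 := is_class_of_comb (-1) hy hTy.
(* The scaled vector is split as [(h^-1 - 1) *: v + v] to match the shape [a *: y + z] of
   [is_class_of_comb]. *)
have -> : h^-1 *: (T h y - y) =
    (h^-1 - 1) *: (-1 *: y + T h y) + (-1 *: y + T h y).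
  by rewrite scalerBl scale1r subrK scaleN1r [- y + _]addrC.
apply: eq_is_class_of (is_class_of_comb (h^-1 - 1) h1 h1) => x _.
rewrite !fctE scalerBl scale1r subrK /difference_quotient -scalerA.
by rewrite scalerBl scale1r scaleN1r [- f x + _]addrC.
Qed.

Lemma negx_multiplier : multiplier wD (wH hK) 1 (fun x => - x).
Proof.
split; first exact: measurable_funN.
move=> x Sx; have x0 := supp_ge0 hK Sx; have r0 := supp_r_gt0 hK Sx.
by rewrite sqrrN expr1n mul1r mulrC /= ler_pM2r// ler_sqr ?nnegrE ?addr_ge0// lerDl.
Qed.

(** The error is multiplication by [difference_quotient h x + x], which lies between 0 and [x + 1]:
    as a map from the space of weight [wD] to H it is bounded by 1 uniformly in [h]. *)
Lemma quotient_cvg (y : Hmu hK n) (yD : L2 wD n) : is_class_of y (L2_fun yD) ->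
  h^-1 *: (T h y - y) @[h --> 0^'+] --> L2_mul negx_multiplier yD.
Proof.
move=> hy; apply/subr_cvg0.
apply: (@L2_mul_cvg0 _ _ _ wD (wH hK) 1
  (fun h x => difference_quotient h x + x) yD).
- move=> h h0; split.
    by apply: measurable_funD => //; exact: measurable_difference_quotient.
  move=> x Sx; have x0 := supp_ge0 hK Sx; have r0 := supp_r_gt0 hK Sx.
  have [a b _] := difference_quotient_bound h0 x0.
  rewrite expr1n mul1r mulrC /= ler_pM2r// ler_sqr ?nnegrE//; last exact: addr_ge0.
  by apply: le_trans b _; rewrite lerDl.
- move=> x Sx; rewrite -[X in _ --> X](addNr x).
  by apply: cvgD (cvg_cst _); exact: difference_quotient_cvg (supp_ge0 hK Sx).
- move=> h h0; rewrite addrC -scaleN1r.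
  apply: eq_is_class_of (is_class_of_comb (-1) (L2_mulE negx_multiplier yD)
    (is_class_of_quotient h0 hy)) => x _.
  by rewrite !fctE !scaleNr scale1r opprK addrC -scalerDl.
Qed.

(** Fatou's lemma along [h = 1 / (k + 1)]: the squared norms of the quotients converge to the finite
    number [|z|^2], while their integrands converge pointwise to [x^2 r |y|^2]. *)
Lemma is_cvg_quotient_dom (y : Hmu hK n) : generator_dom T y ->
  (\int[mu]_(x in supp mu)
     (x ^+ 2 * r x * enorm (L2_fun y x) ^+ 2)%:E < +oo)%E.
Proof.
move=> /cvg_ex[z hz]; have hy := is_class_of_self y.
have nz : `|h^-1 *: (T h y - y)| ^+ 2 @[h --> 0^'+] --> `|z| ^+ 2.
  by rewrite expr2; under eq_fun do rewrite expr2; apply: cvgM; exact: cvg_norm hz.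
pose u k : R := k.+1%:R^-1.
have u0 k : 0 < u k by rewrite invr_gt0.
have {}nz : `|(u k)^-1 *: (T (u k) y - y)| ^+ 2 @[k --> \oo] --> `|z| ^+ 2.
  have /cvg_at_rightP := nz; apply; split=> //; exact: cvg_harmonic.
pose q k x : 'cV[R]_n := difference_quotient (u k) x *: L2_fun y x.
have hq k := is_class_of_quotient (u0 k) hy.
have Lq k : square_integrable (wH hK) (q k) by have /is_class_ofP[] := hq k.
pose F k x := (wH hK x * dot (q k x) (q k x))%:E.
have mF k : measurable_fun (supp mu : set (measurableTypeR R)) (F k).
  by apply/measurable_EFinP; apply: measurable_wdot; exact: (Lq k).1.
have F0 k x : supp mu x -> (0 <= F k x)%E.
  by move=> Sx; rewrite lee_fin; exact: (wdot_ge0 (wH hK) (q k) Sx).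
have intF : (\int[mu]_(x in supp mu) F k x)%E @[k --> \oo] --> (`|z| ^+ 2)%:E.
  rewrite [X in X @ _ --> _](_ : _ = EFin \o
      (fun k => `|(u k)^-1 *: (T (u k) y - y)| ^+ 2)); last first.
    by apply/funext => k /=; rewrite (is_class_of_sqr_norm (hq k)) -(sqint_ip (Lq k)) sqintE.
  by apply: cvg_EFin; [exact: nearW|exact: nz].
have := fatou mu mS mF F0; rewrite (cvg_limn_einf_sup intF).1.
move=> /le_lt_trans/(_ (ltry _)); congr (_ < _)%E.
apply: eq_integral => x /set_mem Sx; apply: (cvg_limn_einf_sup _).1.
apply: cvg_EFin; first exact: nearW.
rewrite [X in X @ _ --> _](_ : _ = fun k => difference_quotient (u k) x *
   difference_quotient (u k) x * (r x * dot (L2_fun y x) (L2_fun y x))); last first.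
  by apply/funext => k; rewrite /F /q /= dotZl dotZr; ring.
rewrite enorm_sqr -(sqrrN x) -mulrA expr2; apply: cvgMl.
have xq : difference_quotient (u k) x @[k --> \oo] --> - x.
  have /cvg_at_rightP := difference_quotient_cvg (supp_ge0 hK Sx); apply.
  by split=> //; exact: cvg_harmonic.
exact: cvgM.
Qed.

(** Both relations are recorded because the representatives chosen for [y] and [yD] may differ on a
    null set. *)
Lemma dom_class (y : Hmu hK n) :
  (\int[mu]_(x in supp mu)
     (x ^+ 2 * r x * enorm (L2_fun y x) ^+ 2)%:E < +oo)%E ->
  exists yD : L2 wD n, is_class_of y (L2_fun yD) /\ is_class_of yD (L2_fun y).
Proof.
move=> /(square_integrable_wDP (L2_funP y)) Ly.
have hD : is_class_of (L2_class Ly) (L2_fun y) by exists Ly.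
exists (L2_class Ly); split=> //.
exact: is_class_of_fun hD (is_class_of_self y).
Qed.

Lemma decay_generator_dom : generator_dom T =
  [set y : Hmu hK n |
    (\int[mu]_(x in supp mu)
       (x ^+ 2 * r x * enorm (L2_fun y x) ^+ 2)%:E < +oo)%E].
Proof.
apply/seteqP; split=> y; first exact: is_cvg_quotient_dom.
by move=> /dom_class[yD [hy _]]; apply/cvg_ex; eexists; exact: quotient_cvg hy.
Qed.

Lemma is_class_of_generator (y : Hmu hK n) : generator_dom T y ->
  is_class_of (generator T y) (fun x => - x *: L2_fun y x).
Proof.
rewrite decay_generator_dom => /dom_class[yD [hy hD]].
rewrite /generator (cvg_lim _ (quotient_cvg hy)); last exact: norm_hausdorff.
exact: is_class_of_mul hD.
Qed.

(** Ensures that an extension, whose values are prescribed at those [y] in V with [VtoH y] in the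
    domain, is prescribed on the entire domain. *)
Lemma generator_dom_Vmu (u : Hmu hK n) : generator_dom T u ->
  exists y : Vmu hK n, VtoH y = u.
Proof.
rewrite decay_generator_dom => /dom_class[yD [hu hD]].
exists (L2_incl wV_le_wD yD); apply: is_class_of_inj (is_class_of_self u).
by do 2!apply: is_class_of_incl.
Qed.

(** * Extension of the generator from V to its dual *)

Lemma extension_multiplier : multiplier (wV hK) (wVd hK) 1 (fun x => - x).
Proof.
split; first exact: measurable_funN.
move=> x Sx; have x0 := supp_ge0 hK Sx; have r0 := supp_r_gt0 hK Sx.
have x1 := supp_x1_gt0 hK Sx.
(* Once [r] is cancelled, the claim is [x ^+ 2 / (x + 1) <= x + 1]. *)
rewrite /= sqrrN expr1n mul1r mulrAC ler_pM2r// mulrC ler_pdivrMr// -expr2.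
by rewrite ler_sqr ?nnegrE ?addr_ge0// lerDl.
Qed.

Definition generator_extension : Vmu hK n -> Vdmu hK n :=
  L2_mul extension_multiplier.

Definition is_generator_extension (A : Vmu hK n -> Vdmu hK n) :=
  linear_contraction A /\
  forall y, generator_dom T (VtoH y) -> A y = HtoVd (generator T (VtoH y)).

Lemma generator_extensionP : is_generator_extension generator_extension.
Proof.
split.
  split; first exact: L2_mul_linear.
  by move=> y; rewrite -[leRHS]mul1r; exact: ler_L2_mul.
move=> y /is_class_of_generator hg.
have hy : is_class_of y (L2_fun (VtoH y)).
  have hV := is_class_of_self y.
  exact: is_class_of_fun (is_class_of_incl (wH_le_wV hK) hV) hV.
apply: is_class_of_inj (is_class_of_mul _ hy) _.
exact: is_class_of_incl hg.
Qed.

(** The constant comes from [(x + 1) * expR (- (x * t)) <= (x + 1) / (1 + x * t) <= 1 + t^-1]. For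
    positive times the semigroup thus sends V into the domain of the generator. *)
Lemma decay_smoothing t : 0 < t ->
  multiplier (wV hK) wD (1 + t^-1) (fun x => expR (- (x * t))).
Proof.
move=> t0; split; first exact: measurable_decay.
move=> x Sx; have x0 := supp_ge0 hK Sx; have r0 := supp_r_gt0 hK Sx.
have xt0 : 0 <= x * t by rewrite mulr_ge0// ltW.
have tV0 : 0 <= t^-1 by rewrite invr_ge0 ltW.
have c0 : 0 <= 1 + t^-1 by rewrite addr_ge0.
have e0 := expR_ge0 (- (x * t)); have e1 := expRN_le1 xt0.
have h : (x + 1) * expR (- (x * t)) <= 1 + t^-1.
  apply: (le_trans (ler_wpM2l _ (expRN_le_inv xt0))); first exact: addr_ge0.
  rewrite ler_pdivrMr ?ltr_pwDl//.
  have -> : (1 + t^-1) * (1 + x * t) = x + 1 + (t^-1 + x * t).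
    by field; rewrite gt_eqF.
  by rewrite lerDl addr_ge0.
rewrite /= mulrAC mulrA ler_pM2r// -exprMn.
have p0 : 0 <= (x + 1) * expR (- (x * t)) by rewrite mulr_ge0// addr_ge0.
apply: (@le_trans _ _ ((1 + t^-1) ^+ 2)); first by rewrite ler_sqr ?nnegrE.
by rewrite ler_peMr ?sqr_ge0// lerDr.
Qed.

Lemma decay_Vmu_dom t (y : Vmu hK n) : 0 < t ->
  generator_dom T (VtoH (decay hK t y)).
Proof.
move=> t0; rewrite decay_generator_dom /=.
set z := VtoH _; apply/(square_integrable_wDP (L2_funP z)).
have hz : is_class_of z (fun x => expR (- (x * t)) *: L2_fun y x).
  exact/is_class_of_incl/(is_class_of_decay hK (ltW t0))/is_class_of_self.
have hD := is_class_of_mul (decay_smoothing t0) (is_class_of_self y).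
by have /is_class_ofP[] := is_class_of_fun hz hD.
Qed.

(* The image of V under the semigroup consists of elements of the domain and is
   dense in V. *)
Lemma generator_extension_unique A B :
  is_generator_extension A -> is_generator_extension B -> A = B.
Proof.
move=> [cA hA] [cB hB]; apply/funext => y.
have yV := @decay_cvg _ _ _ _ hK _ _ y.
have hc (C : Vmu hK n -> Vdmu hK n) : linear_contraction C ->
    C (decay hK t y) @[t --> 0^'+] --> C y.
  by move=> cC; apply: (cvg_comp _ C yV); exact: linear_contraction_continuous.
rewrite -(cvg_lim (@norm_hausdorff _ _) (hc A cA)).
apply: cvg_lim; first exact: norm_hausdorff.
(* For [t > 0] both operators are given by the generator at [decay t y], so their limits at [y]
   coincide. *)
apply: cvg_trans (hc B cB); apply: near_eq_cvg; near=> t.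
by rewrite hA ?hB//; exact: decay_Vmu_dom.
Unshelve. all: by end_near. Qed.

(** The identity [- x * r x = r x - (x + 1) * r x] is integrated against [|y|^2], both terms being
    integrable for [y] in V. The sign is that of [wH - wV]. *)
Lemma generator_extension_pairing (y : Vmu hK n) :
  pairing (generator_extension y) y = - `|y| ^+ 2 + `|VtoH y| ^+ 2 /\
  - `|y| ^+ 2 + `|VtoH y| ^+ 2 <= 0.
Proof.
have hy := is_class_of_self y.
have LV := L2_funP y; have LH := square_integrable_le (wH_le_wV hK) LV.
have nV := is_class_of_sqr_norm hy.
have nH := is_class_of_sqr_norm (is_class_of_incl (wH_le_wV hK) hy).
rewrite nV nH; split; last first.
  rewrite addrC subr_le0; apply: le_Rintegral; [exact: mS|exact: sqint_integrable..|].
  by move=> x Sx; rewrite ler_wpM2r ?dot_ge0// wH_le_wV.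
have hA := L2_mulE extension_multiplier y.
have /is_class_ofP[LA aeA] := hA.
rewrite /pairing (eq_ip _ _ LA.1 LV.1 LV.1 aeA); [|exact: (L2_funP _).1|exact: ae_eq_refl].
rewrite addrC /ip -RintegralB//; [|exact: mS|exact: sqint_integrable..].
by apply: eq_Rintegral => x _; rewrite dotZl /=; ring.
Qed.

End generator.

Theorem lemma2p5 (R : realType) (K : R -> R)
    (mu : {measure set (measurableTypeR R) -> \bar R}) (r : R -> R)
    (hK : kernel_assumption K mu r) :
           
  ((forall (n : nat) (b : 'cV[R]_n),
      exists2 y : Hmu hK n, is_class_of y (fun=> b) &
        `|y| = Num.sqrt (\int[mu]_(x in supp mu) r x) * enorm b) /\
   (forall (n d : nat) (sigma : 'M[R]_(n, d)),
      exists S : 'cV[R]_d -> Hmu hK n,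
        [/\ linear S, continuous S,
            forall v, is_class_of (S v) (fun=> sigma *m v) &
            forall e : 'I_d -> 'cV[R]_d, orthonormal_basis e ->
              HS_norm e S =
              Num.sqrt (\int[mu]_(x in supp mu) r x) * enorm sigma])) /\
            
  (forall n : nat,
    exists T : R -> Hmu hK n -> Hmu hK n,
      (forall (t : R) (y : Hmu hK n), 0 <= t ->
         is_class_of (T t y) (fun x => expR (- (x * t)) *: L2_fun y x)) /\
      (forall t : R, 0 <= t -> linear_contraction (T t)) /\
      C0_semigroup T /\
      generator_dom T =
        [set y : Hmu hK n |
          (\int[mu]_(x in supp mu)
             (x ^+ 2 * r x * enorm (L2_fun y x) ^+ 2)%:E < +oo)%E] /\
      (forall y : Hmu hK n, generator_dom T y ->
         is_class_of (generator T y) (fun x => - x *: L2_fun y x)) /\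
      (forall u : Hmu hK n, generator_dom T u -> exists y : Vmu hK n, VtoH y = u) /\
      let is_extension (A : Vmu hK n -> Vdmu hK n) :=
        linear_contraction A /\
        (forall y : Vmu hK n, generator_dom T (VtoH y) ->
           A y = HtoVd (generator T (VtoH y))) in
      (exists! A, is_extension A) /\
      (forall A, is_extension A -> forall y : Vmu hK n,
         pairing (A y) y = - `|y| ^+ 2 + `|VtoH y| ^+ 2 /\
         - `|y| ^+ 2 + `|VtoH y| ^+ 2 <= 0)) /\
             
  ((forall (n : nat) (y : Vmu hK n),
      bochner_integrable mu (L2_fun y) /\
      \int[mu]_(x in supp mu) enorm (L2_fun y x) <=
        Num.sqrt (\int[mu]_(x in supp mu) r x) * `|y|) /\
   (forall eps : R, 0 < eps -> exists2 M : R, 0 < M &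
      forall (n : nat) (y : Vmu hK n),
        (\int[mu]_(x in supp mu) enorm (L2_fun y x)) ^+ 2 <=
          eps * `|y| ^+ 2 + M * `|VtoH y| ^+ 2)).
Proof.
split; [split|split].
- move=> n b; exists (cst_class hK b); first exact: cst_classE.
  exact/is_class_of_cst_norm/cst_classE.
- move=> n d sigma; exists (fun v => cst_class hK (sigma *m v)); split.
  + by move=> a u v; rewrite linearP cst_class_linear.
  + exact: cst_class_mul_continuous.
  + by move=> v; exact: cst_classE.
  + move=> e he; rewrite /HS_norm -[enorm sigma]ger0_norm ?enorm_ge0//.
    rewrite -sqrtr_sqr -sqrtrM; last first.
      by apply: Rintegral_ge0 => x Sx; rewrite ltW// (supp_r_gt0 hK).
    rewrite -(HS_norm_enorm sigma he) mulr_sumr; congr Num.sqrt.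
    apply: eq_bigr => k _; rewrite (is_class_of_cst_norm (cst_classE hK _)).
    rewrite exprMn sqr_sqrtr//.
    by apply: Rintegral_ge0 => x Sx; rewrite ltW// (supp_r_gt0 hK).
- move=> n; exists (@decay _ _ _ _ hK (wH hK) n).
  split; first by move=> t y t0; exact/is_class_of_decay/is_class_of_self.
  split; first by move=> t _; exact: decay_contraction.
  split; first exact: decay_C0.
  split; first exact: decay_generator_dom.
  split; first exact: is_class_of_generator.
  split; first exact: generator_dom_Vmu.
  move=> is_extension; split.
    exists (@generator_extension _ _ _ _ hK n); split; first exact: generator_extensionP.
    by move=> A hA; exact: generator_extension_unique (generator_extensionP hK) hA.
  move=> A hA y.
  (* By uniqueness any extension is the multiplication operator, for which the pairing is
     explicit. *)
  rewrite (generator_extension_unique hA (generator_extensionP hK)).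
  exact: generator_extension_pairing.
- split; first exact: Vmu_integrable.
  exact: Vmu_interpolation.
Qed.
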